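(* Let $\mathfrak a$ be one of the four bigraded Lie algebras $\mathrm{gr}_{dpth}(\mathfrak{u^m})\subset\mathrm{gr}_{dpth}(\mathfrak{grt}_1)\subset\mathrm{gr}_{dpth}(\mathfrak{ds}_0)\subset\mathfrak{ls}$. Then the statement ''$H_k(\mathfrak a)=0$ for every $k\geq 3$'' is equivalent to the statement ''$H_3(\mathfrak a)=0$''.
   Context: Everything is over $\mathbb Q$. $H_k(\cdot)$ is Lie algebra homology with trivial coefficients. **The ambient Lie algebra.** Let $\mathfrak g=\mathbb L(e_0,e_1)\subset\mathbb Q\langle e_0,e_1\rangle$ be the free Lie algebra, with bracket $[,]$. Weight: $e_0,e_1$ have weight 1. Depth: $e_1$ has depth 1, $e_0$ depth 0. For $f\in\mathfrak g$ let $D_f$ be the derivation of $(\mathfrak g,[,])$ with $e_0\mapsto 0$, $e_1\mapsto[e_1,f]$. The Poisson-Ihara bracket is $\langle f,g\rangle=[f,g]+D_f(g)-D_g(f)$; $(\mathfrak g,\langle,\rangle)$ is a (weight, depth)-bigraded Lie algebra. Let $F^d\mathfrak g$ be the part of depth $\geq d$. For a weight-graded Lie subalgebra $\mathfrak h$ of $(\mathfrak g,\langle,\rangle)$, $\mathrm{gr}_{dpth}(\mathfrak h)=\bigoplus_d(\mathfrak h\cap F^d\mathfrak g)/(\mathfrak h\cap F^{d+1}\mathfrak g)$, viewed as a bigraded Lie subalgebra of $\mathrm{gr}(\mathfrak g,\langle,\rangle)=(\mathfrak g,\langle,\rangle)$. **$\mathfrak{u^m}$.** Let $\mathrm{MT}(\mathbb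 Z)$ be the Tannakian category of mixed Tate motives over $\mathbb Z$ with its de Rham fibre functor; the automorphism group of this functor is $\mathcal U\rtimes\mathbb G_m$ with $\mathcal U$ prounipotent. $\mathfrak{u^m}$ is the (positively) weight-graded Lie algebra of $\mathcal U$; it is free with one generator in each odd weight $\geq3$. It acts on the Lie algebra of the de Rham fundamental group of $\mathbb P^1\setminus\{0,1,\infty\}$ at the tangential base point $\partial/\partial t$ at $0$ (the completion of $\mathfrak g$, with $e_0,e_1$ dual to $dt/t,dt/(t-1)$): $\sigma\in\mathfrak{u^m}$ acts by $e_0\mapsto0$, $e_1\mapsto[e_1,f_\sigma]$ for a unique $f_\sigma\in\mathfrak g$ with zero coefficient of $e_1$. The map $\sigma\mapsto f_\sigma$ is injective, and $\mathfrak{u^m}$ is identified with its image, a weight-graded Lie subalgebra of $(\mathfrak g,\langle,\rangle)$. **$\mathfrak{grt}_1$** is the set of $\psi\in\mathfrak g$, written $\psi(A,B)$ with $A=e_0,B=e_1$, such that $\psi(B,A)=-\psi(A,B)$; $\psi(A,B)+\psi(B,C)+\psi(C,A)=0$ and $[B,\psi(A,B)]+[C,\psi(A,C)]=0$ for $C=-A-B$; and $\psi(X_{12},X_{23}+X_{24})+\psi(X_{13}+X_{23},X_{34})=\psi(X_{23},X_{34})+\psi(X_{12}+X_{13},X_{24}+X_{34})+\psi(X_{12},X_{23})$ in the Lie algebra with generators $X_{ij}=X_{ji}$ ($1\le i\neq j\le4$) and relations $[X_{ij},X_{kl}]=0$, $[X_{ij}+X_{ik},X_{jk}]=0$ for distinct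 indices. **$\mathfrak{ds}_0$** is the set of $\psi\in\mathfrak g$ whose coefficients of $e_0$, $e_1$, $e_0e_1$ vanish and such that $\psi_*=\pi_Y(\psi)+\sum_{n\ge2}\frac{(-1)^{n-1}}n(\pi_Y(\psi)|y_n)\,y_1^n$ is primitive for the coproduct $\Delta_*$ of $\mathbb Q\langle y_1,y_2,\dots\rangle$, $\Delta_*(y_n)=y_n\otimes1+1\otimes y_n+\sum_{k=1}^{n-1}y_k\otimes y_{n-k}$. Here $\pi_Y$ is the linear map killing $1$ and words ending in $e_0$, with $e_0^{n_1-1}e_1\cdots e_0^{n_d-1}e_1\mapsto(-1)^dy_{n_1}\cdots y_{n_d}$, and $(\cdot|y_n)$ is the coefficient of $y_n$. **$\mathfrak{ls}$.** For $f\in\mathfrak g$ of depth $d\ge1$, let $\rho(f)(y_0,\dots,y_d)$ be the image of $f$ under $e_0^{a_0}e_1e_0^{a_1}\cdots e_1e_0^{a_d}\mapsto y_0^{a_0}\cdots y_d^{a_d}$, and $\bar f(x_1,\dots,x_d)=\rho(f)(0,x_1,\dots,x_d)$. Then $\mathfrak{ls}=\bigoplus_{d\ge1}\mathfrak{ls}_d$, where $\mathfrak{ls}_1$ is spanned by $\mathrm{ad}(e_0)^{2a}(e_1)$, $a\ge1$, and for $d\ge2$, $\mathfrak{ls}_d$ is the set of $f\in\mathfrak g$ of depth $d$ such that for all $1\le p<d$ the sum of $\bar f(x_{w})$ over all words $w$ in the shuffle of $(1,\dots,p)$ with $(p+1,\dots,d)$ is $0$. It is a bigraded Lie subalgebra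 of $(\mathfrak g,\langle,\rangle)$. Known: there are inclusions of bigraded Lie algebras $\mathrm{gr}_{dpth}(\mathfrak{u^m})\subset\mathrm{gr}_{dpth}(\mathfrak{grt}_1)\subset\mathrm{gr}_{dpth}(\mathfrak{ds}_0)\subset\mathfrak{ls}\subset(\mathfrak g,\langle,\rangle)$. *)

(* Defs.v *)
From HB Require Import structures.
From mathcomp Require Import all_boot all_order all_algebra.
From mathcomp Require Import finmap.
From mathcomp Require Import reals topology normedtype sequences.
From mathcomp.multinomials Require monalg.
(* Some notations of monalg clash with those of topology. *)
Import -(notations) monalg.

Set Implicit Arguments.
Unset Strict Implicit.
Unset Printing Implicit Defensive.

Import GRing.Theory numFieldNormedType.Exports.
Local Open Scope ring_scope.

Notation "{ 'malg' G [ K ] }" := (@malg K G)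
  (at level 0, K, G at level 2, format "{ 'malg'  G [ K ] }") : type_scope.
Notation "f @_ k" := (mcoeff k f)
  (at level 3, k at level 2, left associativity) : ring_scope.
Notation "<< k >>" := (mkmalgU k 1) (at level 0) : ring_scope.
Notation "{ 'fmonom' I }" := (fmonom I)
  (at level 0, I at level 2, format "{ 'fmonom'  I }") : type_scope.

(** * Linear algebra over Q *)

Inductive span (V : lmodType rat) (S : V -> Prop) : V -> Prop :=
| span_gen x of S x : span S x
| span0 : span S 0
| spanP c x y of span S x & span S y : span S (c *: x + y).

(* The linear map defined on the free module on [K] by its values on [K]. *)
Definition linext (K : choiceType) (V : lmodType rat) (F : K -> V)
    (f : {malg rat[K]}) : V :=
  \sum_(k <- msupp f) f@_k *: F k.

Record is_lie_bracket (L : lmodType rat) (br : L -> L -> L) : Prop := {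
  bracketPl : forall c x y z, br (c *: x + y) z = c *: br x z + br y z;
  bracketPr : forall c x y z, br z (c *: x + y) = c *: br z x + br z y;
  bracketxx : forall x, br x x = 0;
  jacobi : forall x y z, br x (br y z) + br y (br z x) + br z (br x y) = 0 }.

(** * Lie algebra homology with trivial coefficients

   The exterior algebra of [L] is the free vector space on finite sequences of
   elements of [L], modulo multilinearity and the vanishing of the sequences
   with a repeated entry; the class of [:: x1; ...; xk] is x1 /\ ... /\ xk. *)

Section Homology.
Variables (L : lmodType rat) (br : L -> L -> L).

Inductive ext_relator : {malg rat[seq L]} -> Prop :=
| ext_multilinear s t c x y :
    ext_relator (<< s ++ (c *: x + y) :: t >>
                 - (c *: << s ++ x :: t >> + << s ++ y :: t >>))
| ext_alternating r s t x : ext_relator << r ++ x :: s ++ x :: t >>.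

Definition ext_eq (c c' : {malg rat[seq L]}) : Prop :=
  span ext_relator (c - c').

Definition ext_degree (k : nat) (c : {malg rat[seq L]}) : Prop :=
  forall s, s \in msupp c -> size s = k.

Definition remove_at (i : nat) (s : seq L) : seq L := take i s ++ drop i.+1 s.

(* The Chevalley-Eilenberg differential. *)
Definition ce_diff : {malg rat[seq L]} -> {malg rat[seq L]} :=
  linext (fun s : seq L => \sum_(j < size s) \sum_(i < j)
    (-1) ^+ (i + j) *:
      << br s`_i s`_j :: remove_at i (remove_at j s) >>).

Definition homology_vanishes (k : nat) : Prop :=
  forall c, ext_degree k c -> ext_eq (ce_diff c) 0 ->
    exists2 b, ext_degree k.+1 b & ext_eq (ce_diff b) c.

End Homology.

(** * Free Lie algebras *)

Notation ncpoly I := {malg rat[{fmonom I}]}.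

Definition letter (I : choiceType) (i : I) : ncpoly I := << fmu i >>.

Definition comm (A : nzRingType) (x y : A) : A := x * y - y * x.

Inductive free_lie (I : choiceType) : ncpoly I -> Prop :=
| free_lie_letter i : free_lie (letter i)
| free_lie0 : free_lie 0
| free_lieP c f g of free_lie f & free_lie g : free_lie (c *: f + g)
| free_lie_comm f g of free_lie f & free_lie g : free_lie (comm f g).

(* The letters e_0 and e_1 are [false] and [true]. *)
Notation nc2 := (ncpoly bool).
Definition e0 : nc2 := letter false.
Definition e1 : nc2 := letter true.

Definition weight (w : seq bool) : nat := size w.
Definition depth (w : seq bool) : nat := count id w.

Definition part (P : pred (seq bool)) : nc2 -> nc2 :=
  linext (fun w : {fmonom bool} => if P w then << w >> else 0).
Definition weight_part (n : nat) := part (fun w => weight w == n).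
Definition depth_part (d : nat) := part (fun w => depth w == d).

(** * The Poisson-Ihara bracket *)

Fixpoint ihara_der_word (f : nc2) (s : seq bool) : nc2 :=
  if s is b :: s' then
    (if b then comm e1 f else 0) * \prod_(x <- s') letter x
    + letter b * ihara_der_word f s'
  else 0.

Definition ihara_der (f : nc2) : nc2 -> nc2 :=
  linext (fun w : {fmonom bool} => ihara_der_word f w).

Definition ihara (f g : nc2) : nc2 :=
  comm f g + ihara_der f g - ihara_der g f.

Record lie_subalgebra (h : nc2 -> Prop) : Prop := {
  lie_subalgebra_sub : forall f, h f -> free_lie f;
  lie_subalgebra0 : h 0;
  lie_subalgebraP : forall c f g, h f -> h g -> h (c *: f + g);
  lie_subalgebra_ihara : forall f g, h f -> h g -> h (ihara f g) }.

Record bigraded_lie := BigradedLie {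
  bl_pred :> {pred nc2};
  bl_lie : lie_subalgebra (fun f => f \in bl_pred);
  bl_weight : forall n f, f \in bl_pred -> weight_part n f \in bl_pred;
  bl_depth : forall d f, f \in bl_pred -> depth_part d f \in bl_pred }.

Section BigradedLieType.
Variable a : bigraded_lie.

Fact bl_submod_closed : submod_closed (bl_pred a).
Proof.
split; first exact: lie_subalgebra0 (bl_lie a).
by move=> c f g fa ga; apply: (lie_subalgebraP (bl_lie a)).
Qed.

HB.instance Definition _ :=
  GRing.isSubmodClosed.Build rat nc2 (bl_pred a) bl_submod_closed.

Definition bl_type := {f : nc2 | f \in bl_pred a}.
HB.instance Definition _ := SubChoice.on bl_type.
HB.instance Definition _ := [SubChoice_isSubLmodule of bl_type by <:].

Definition bl_bracket (f g : bl_type) : bl_type :=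
  exist _ (ihara (val f) (val g))
    (lie_subalgebra_ihara (bl_lie a) (valP f) (valP g)).

End BigradedLieType.

(* [gr_dpth h]: the image of (h /\ F^d) / (h /\ F^d.+1) in F^d / F^d.+1 is
   identified with a space of elements that are homogeneous of depth d. *)
Definition gr_dpth (h : nc2 -> Prop) (f : nc2) : Prop :=
  forall d, exists2 g, h g &
    (forall w : {fmonom bool}, (depth w < d)%N -> g@_w = 0) /\
    depth_part d g = depth_part d f.

(** * The Lie algebra grt_1 *)

Definition subst (J : choiceType) (psi : nc2) (a b : ncpoly J) : ncpoly J :=
  linext (fun w : {fmonom bool} =>
    \prod_(x <- (w : seq bool)) (if x then b else a)) psi.

Definition br4 (i j : 'I_4) : ncpoly ('I_4 * 'I_4)%type := letter (i, j).

Inductive braid4_relator : ncpoly ('I_4 * 'I_4)%type -> Prop :=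
| braid4_diag i : braid4_relator (br4 i i)
| braid4_sym i j : braid4_relator (br4 i j - br4 j i)
| braid4_comm i j k l of uniq [:: i; j; k; l] :
    braid4_relator (comm (br4 i j) (br4 k l))
| braid4_triple i j k of uniq [:: i; j; k] :
    braid4_relator (comm (br4 i j + br4 i k) (br4 j k)).

Inductive braid4_ideal : ncpoly ('I_4 * 'I_4)%type -> Prop :=
| braid4_ideal_gen f of braid4_relator f : braid4_ideal f
| braid4_ideal0 : braid4_ideal 0
| braid4_idealP c f g of braid4_ideal f & braid4_ideal g :
    braid4_ideal (c *: f + g)
| braid4_ideal_comm f g of free_lie f & braid4_ideal g :
    braid4_ideal (comm f g).

Definition braid4_eq (f g : ncpoly ('I_4 * 'I_4)%type) : Prop :=
  braid4_ideal (f - g).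

(* The generators with their usual indices 1, 2, 3, 4 *)
Definition Xij (i j : nat) : ncpoly ('I_4 * 'I_4)%type :=
  br4 (inord i.-1) (inord j.-1).

Definition grt1 (psi : nc2) : Prop :=
  let C := - e0 - e1 in
  [/\ free_lie psi,
      subst psi e1 e0 = - psi,
      psi + subst psi e1 C + subst psi C e0 = 0,
      comm e1 psi + comm C (subst psi e0 C) = 0
    & braid4_eq
        (subst psi (Xij 1 2) (Xij 2 3 + Xij 2 4)
         + subst psi (Xij 1 3 + Xij 2 3) (Xij 3 4))
        (subst psi (Xij 2 3) (Xij 3 4)
         + subst psi (Xij 1 2 + Xij 1 3) (Xij 2 4 + Xij 3 4)
         + subst psi (Xij 1 2) (Xij 2 3))].

(** * The double shuffle Lie algebra ds_0 *)

(* The letter [n] stands for y_n; the letter [0] never occurs below. *)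
Notation ncY := (ncpoly nat).
Notation ncYY := {malg rat[({fmonom nat} * {fmonom nat})%type]}.

(* [yword 0] sends e_0^(n_1-1) e_1 ... e_0^(n_d-1) e_1 to
   y_(n_1) ... y_(n_d); the first argument counts the pending e_0. *)
Fixpoint yword (k : nat) (s : seq bool) : {fmonom nat} :=
  match s with
  | [::] => fmone nat
  | false :: s' => yword k.+1 s'
  | true :: s' => fmmul (fmu k.+1) (yword 0 s')
  end.

Definition piY : nc2 -> ncY :=
  linext (fun w : {fmonom bool} =>
    if last false w then (-1) ^+ depth w *: << yword 0 w >> else 0).

Definition psi_star (psi : nc2) : ncY :=
  piY psi + linext (fun w : {fmonom nat} =>
    if (w : seq nat) is [:: n] then
      if (2 <= n)%N then ((-1) ^+ n.-1 / n%:R) *: letter 1%N ^+ n else 0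
    else 0) (piY psi).

Definition tensor (f g : ncY) : ncYY :=
  linext (fun u => linext (fun v => << (u, v) >>) g) f.

Definition tensor_mul (p q : ncYY) : ncYY :=
  linext (fun u : {fmonom nat} * {fmonom nat} =>
    linext (fun v : {fmonom nat} * {fmonom nat} =>
      << (fmmul u.1 v.1, fmmul u.2 v.2) >>) q) p.

Definition Delta_letter (n : nat) : ncYY :=
  tensor (letter n) 1 + tensor 1 (letter n)
  + \sum_(1 <= k < n) tensor (letter k) (letter (n - k)%N).

Definition Delta_star : ncY -> ncYY :=
  linext (fun w : {fmonom nat} =>
    foldr (fun n => tensor_mul (Delta_letter n)) (tensor 1 1) w).

Definition ds0 (psi : nc2) : Prop :=
  [/\ free_lie psi,
      psi@_(fmu false) = 0,
      psi@_(fmu true) = 0,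
      psi@_(fmmul (fmu false) (fmu true)) = 0
    & Delta_star (psi_star psi)
      = tensor (psi_star psi) 1 + tensor 1 (psi_star psi)].

(** * The linearized double shuffle Lie algebra ls *)

Fixpoint shuffle (T : Type) (s : seq T) : seq T -> seq (seq T) :=
  if s is x :: s' then
    fix shuffle_s (t : seq T) : seq (seq T) :=
      if t is y :: t' then
        [seq x :: w | w <- shuffle s' t] ++ [seq y :: w | w <- shuffle_s t']
      else [:: s]
  else fun t => [:: t].

Notation poly_in n := {malg rat[(cmonom 'I_n)]}.

Definition pvar (n : nat) (i : 'I_n) : poly_in n := << ucm i >>.

Definition peval (n m : nat) (p : poly_in n) (v : 'I_n -> poly_in m) :
    poly_in m :=
  linext (fun mon : cmonom 'I_n => \prod_(i < n) v i ^+ mon i) p.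

(* e_0^(a_0) e_1 e_0^(a_1) ... e_1 e_0^(a_d) |-> [:: a_0; a_1; ...; a_d] *)
Fixpoint gaps (s : seq bool) : seq nat :=
  match s with
  | [::] => [:: 0%N]
  | false :: s' => (head 0%N (gaps s')).+1 :: behead (gaps s')
  | true :: s' => 0%N :: gaps s'
  end.

Definition rho (d : nat) : nc2 -> poly_in d.+1 :=
  linext (fun w : {fmonom bool} =>
    \prod_(i < d.+1) pvar i ^+ nth 0%N (gaps w) i).

Definition fbar (d : nat) (f : nc2) : poly_in d :=
  peval (rho d f) (fun i => if unlift ord0 i is Some j then pvar j else 0).

Definition ls_depth (d : nat) (f : nc2) : Prop :=
  match d with
  | 0 => f = 0
  | 1 => span (fun g => exists2 a, (1 <= a)%N & g = iter a.*2 (comm e0) e1) f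
  | _ =>
    [/\ free_lie f, depth_part d f = f
      & forall p, (1 <= p < d)%N ->
          \sum_(w <- shuffle (take p (enum 'I_d)) (drop p (enum 'I_d)))
            peval (fbar d f) (fun i => pvar (nth i w i)) = 0]
  end.

Definition ls (f : nc2) : Prop := forall d, ls_depth d (depth_part d f).

(** * The motivic Lie algebra u^m

   In the absence of the category MT(Z), the image of u^m in (g, <,>) is
   described by [motivic_lie].  Its clauses are known properties of this image,
   and at most one subspace of g satisfies them.

   The clause [motivic_period] says that the straight path dch from 0 to 1,
   seen as a real point of the de Rham path torsor, lies in the orbit under the
   prounipotent group of u^m of a rational, weight-even point evaluated at
   zeta(2): the motivic multiple zeta values form a comodule algebra isomorphic
   to O(U) [zeta^m(2)], and the coordinates of dch are its real periods.

   Uniqueness: if u_n is known for n < N, this clause fixes the component in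
   weight N of the element of the group, up to the real span of brackets of
   elements of lower weight.  For N odd its coefficient of e_0^(N-1) e_1 is
   - zeta(N) <> 0, whereas the brackets have depth at least 2; hence it
   determines the missing generator of u up to brackets. *)

Record free_on (u : nc2 -> Prop) (sigma : nat -> nc2) : Prop := {
  free_on_in : forall n, u (sigma n);
  free_on_univ : forall (L : lmodType rat) (br : L -> L -> L),
    is_lie_bracket br -> forall s : nat -> L,
    let extends (phi : nc2 -> L) :=
      [/\ forall c f g, u f -> u g -> phi (c *: f + g) = c *: phi f + phi g,
          forall f g, u f -> u g -> phi (ihara f g) = br (phi f) (phi g)
        & forall n, phi (sigma n) = s n] in
    exists2 phi, extends phi
      & forall phi', extends phi' -> forall f, u f -> phi' f = phi f }.

Section Periods.
Variable R : realType.
Local Open Scope classical_set_scope.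

(* Noncommutative formal power series in e_0, e_1 *)
Definition ncseries (K : Type) := seq bool -> K.

Definition group_like (K : nzRingType) (X : ncseries K) : Prop :=
  X [::] = 1 /\ forall u v, X u * X v = \sum_(w <- shuffle u v) X w.

(* The sum of k_1^-n_1 ... k_d^-n_d over N > k_1 > ... > k_d > 0 *)
Fixpoint mzv_trunc (ns : seq nat) (N : nat) : R :=
  if ns is n :: ns' then
    \sum_(1 <= k < N) k%:R ^- n * mzv_trunc ns' k
  else 1.

Definition mzv (ns : seq nat) : R := limn (mzv_trunc ns).

Definition eword (ns : seq nat) : seq bool :=
  flatten [seq rcons (nseq n.-1 false) true | n <- ns].

(* The series of shuffle-regularized iterated integrals of dt/t and dt/(t-1)
   along dch; the leftmost letter is the form integrated closest to 1. *)
Record is_dch (X : ncseries R) : Prop := {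
  dch_group_like : group_like X;
  dch_e0 : X [:: false] = 0;
  dch_e1 : X [:: true] = 0;
  dch_mzv : forall ns, all (leq 1) ns -> (2 <= head 0 ns)%N ->
    X (eword ns) = (-1) ^+ size ns * mzv ns }.

(* [h] lies in the completion of the tensor product of [u] with R. *)
Definition in_completion (u : nc2 -> Prop) (h : ncseries R) : Prop :=
  forall n, exists2 cs : seq (R * nc2),
    (forall c, c \in cs -> u c.2) &
    forall w : {fmonom bool}, weight w = n ->
      h w = \sum_(c <- cs) c.1 * ratr (c.2)@_w.

(* X |-> h X + D_h(X), the infinitesimal action of h on the path torsor; its
   group version is X |-> F X(e_0, F^-1 e_1 F). *)
Definition torsor_action (h X : ncseries R) : ncseries R := fun w =>
  \sum_(i < (size w).+1) h (take i w) * X (drop i w)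
  + \sum_(j < (size w).+1) \sum_(i < j)
      (* w = w1 v w2 with v = drop i (take j w) non empty, and the coefficient
         of v in [e_1, h] *)
      let v := drop i (take j w) in
      ((if head false v then h (behead v) else 0)
       - (if last false v then h (belast (head false v) (behead v)) else 0))
      * X (take i w ++ true :: drop j w).

(* The k-th iterate only contributes to weights at least k when h has no
   constant term. *)
Definition exp_action (h X : ncseries R) : ncseries R := fun w =>
  \sum_(k < (size w).+1) (k`!%:R)^-1 * iter k (torsor_action h) X w.

Record motivic_lie (u : nc2 -> Prop) : Prop := {
  motivic_sub : lie_subalgebra u;
  motivic_weight : forall n f, u f -> u (weight_part n f);
  motivic_e1 : forall f, u f -> f@_(fmu true) = 0;
  motivic_free : exists2 sigma : nat -> nc2, free_on u sigma
    & forall n, weight_part (n.*2 + 3) (sigma n) = sigma n;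
  motivic_period : exists X h (gamma : ncseries rat),
    [/\ is_dch X, in_completion u h, group_like gamma,
        forall w, odd (weight w) -> gamma w = 0
      & X =1 exp_action h (fun w =>
          ratr (gamma w) * mzv [:: 2%N] ^+ (weight w)./2)] }.

End Periods.

(* Main.v *)
Require Import Defs.
From HB Require Import structures.
From mathcomp Require Import all_boot all_order all_algebra.
From mathcomp Require Import finmap boolp reals.
From mathcomp.multinomials Require monalg.
Import -(notations) monalg.
(* Imported again, so that [span] is not the one of [vector]. *)
Import Defs.

(* The statement holds for every Lie algebra L graded by positive weights and
   finite dimensional in each weight, and for every degree: if H_n(L) = 0, then
   H_(n+1)(L) = 0.  Remove from L one homogeneous basis element after the other,
   by increasing weight: this gives a chain of ideals I in J = I + Q x.  If
   H_n(J) = 0, then the coinvariants of x on H_n(I) vanish, hence H_n(I) = 0 by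
   Nakayama's lemma, as x has positive weight; it follows that H_(n+1)(J) is a
   quotient of H_(n+1)(I).  For a given weight w, this chain reaches an ideal
   without nonzero element of weight at most w, whose H_(n+1) is 0 in weight w. *)

Set Implicit Arguments.
Unset Strict Implicit.
Unset Printing Implicit Defensive.

Import GRing.Theory Num.Theory.
Local Open Scope ring_scope.

(** * Spans, free modules and quotients *)

(** If J = I + Q x, the exterior algebra of J is that of I plus x /\ that of I. This gives an exact
    sequence H_n(I) -> H_n(I) -> H_n(J) -> H_(n-1)(I) -> H_(n-1)(I) whose outer maps are the action
    of x; the proof carries out its content directly on cycles and boundaries. Two obstacles shape
    the argument. As L may be infinite dimensional, the chain of ideals need not end; hence
    everything is restricted to weights at most w, and neither step of the argument leaves this
    range. Moreover no basis of L is given: the ideals are common kernels of coefficient functionals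
    of words, listed by weight, so two consecutive ideals may coincide. *)

Section Span.
Variable V : lmodType rat.
Implicit Types (S T : V -> Prop) (x y : V).

Lemma spanD S x y : span S x -> span S y -> span S (x + y).
Proof. by move=> Sx Sy; rewrite -[x]scale1r; apply: spanP. Qed.

Lemma spanZ S c x : span S x -> span S (c *: x).
Proof. by move=> Sx; rewrite -[_ *: _]addr0; apply: spanP Sx (span0 S). Qed.

Lemma spanN S x : span S x -> span S (- x).
Proof. by rewrite -scaleN1r; apply: spanZ. Qed.

Lemma spanB S x y : span S x -> span S y -> span S (x - y).
Proof. by move=> Sx /spanN; apply: spanD. Qed.

Lemma span_sum S (I : Type) (r : seq I) (P : pred I) (F : I -> V) :
  (forall i, P i -> span S (F i)) -> span S (\sum_(i <- r | P i) F i).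
Proof. by move=> SF; apply: big_ind => //; [apply: span0 | apply: spanD]. Qed.

Lemma span_map (W : lmodType rat) S (T : W -> Prop) (f : {linear V -> W}) :
  (forall x, S x -> span T (f x)) -> forall x, span S x -> span T (f x).
Proof.
move=> ST x; elim=> {x} [x /ST //||c x y _ Tx _ Ty].
  by rewrite linear0; apply: span0.
by rewrite linearP; apply: spanP.
Qed.

Lemma span_eq0 (W : lmodType rat) S (f : {linear V -> W}) :
  (forall x, S x -> f x = 0) -> forall x, span S x -> f x = 0.
Proof.
move=> f0 x; elim=> {x} [x /f0 //||c x y _ fx _ fy]; first exact: linear0.
by rewrite linearP fx fy scaler0 addr0.
Qed.

(** The number of terms is left open upwards, so that two decompositions can be added, or a given
    index included, by enlarging the range. *)
Lemma span_union (C : nat -> V -> Prop) x :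
  span (fun y => exists v, span (C v) y) x ->
  exists N (f : nat -> V), (forall v, span (C v) (f v)) /\
    forall M, (N <= M)%N -> x = \sum_(v < M) f v.
Proof.
elim=> {x} [x [v Cx]||c x y _ [N [f [Cf Ef]]] _ [M [g [Cg Eg]]]].
- exists v.+1, (fun i => if i == v then x else 0); split=> [i|M vM].
    by case: eqP => [->|_] //; apply: span0.
  rewrite (bigD1 (Ordinal vM)) //= eqxx big1 ?addr0 // => i.
  by rewrite -val_eqE /= => /negPf->.
- exists 0%N, (fun=> 0); split=> [v|M _]; first exact: span0.
  by rewrite big1.
exists (maxn N M), (fun v => c *: f v + g v); split=> [v|K].
  by apply: spanP.
rewrite geq_max => /andP[NK MK].
by rewrite big_split /= -scaler_sumr -Ef // -Eg.
Qed.

End Span.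

Lemma span_sub (V : lmodType rat) (S T : V -> Prop) :
  (forall x, S x -> span T x) -> forall x, span S x -> span T x.
Proof. exact: (span_map (f := idfun)). Qed.

Section Linext.
Variables (K : choiceType) (V : lmodType rat).
Implicit Types (F : K -> V) (f : {malg rat[K]}).

(** The range of the sum in [linext] depends on [f]; linearity needs a common range for several
    elements. *)
Lemma linextEw F (d : {fset K}) f : (msupp f `<=` d)%fset ->
  linext F f = \sum_(k <- d) f@_k *: F k.
Proof.
move=> fd; rewrite /linext (big_fset_incl _ fd) //=.
by move=> k _ /mcoeff_outdom->; rewrite scale0r.
Qed.

Lemma linext_is_linear F : linear (linext F).
Proof.
move=> c f g; pose d := (msupp f `|` msupp g `|` msupp (c *: f + g))%fset.
rewrite !(@linextEw _ d) /d ?fsubsetUr //; last first.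
- by rewrite -fsetUA fsubsetUl.
- by rewrite fsetUC fsetUA fsubsetUr.
rewrite scaler_sumr -big_split; apply: eq_bigr => k _ /=.
by rewrite mcoeffD mcoeffZ scalerDl scalerA.
Qed.

HB.instance Definition _ F :=
  GRing.isLinear.Build rat {malg rat[K]} V _ (linext F) (linext_is_linear F).

Lemma linextU F k : linext F << k >> = F k.
Proof. by rewrite /linext msuppU oner_eq0 big_seq_fset1 mcoeffUU scale1r. Qed.

Lemma malgZE f : f = \sum_(k <- msupp f) f@_k *: << k >>.
Proof.
rewrite [LHS]monalgE; apply: eq_bigr => k _; apply/malgP => k'.
by rewrite mcoeffZ !mcoeffU mulr_natr.
Qed.

Lemma malg_span (S : {malg rat[K]} -> Prop) f :
  (forall k, k \in msupp f -> span S << k >>) -> span S f.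
Proof.
move=> Sf; rewrite [f]malgZE big_seq; apply: span_sum => k /Sf.
exact: spanZ.
Qed.

Lemma malg_eq_linear (g h : {linear {malg rat[K]} -> V}) :
  (forall k, g << k >> = h << k >>) -> g =1 h.
Proof.
move=> gh f; rewrite [f]malgZE !linear_sum; apply: eq_bigr => k _.
by rewrite !linearZ_LR gh.
Qed.

End Linext.

Section QuotientModule.
Variables (V : lmodType rat) (S : V -> Prop).

Definition span_pred : {pred V} := fun x => `[< span S x >].

Fact span_zmod_closed : zmod_closed span_pred.
Proof.
split=> [|x y]; first exact/asboolP/span0.
by move=> /asboolP Sx /asboolP Sy; apply/asboolP/spanB.
Qed.

HB.instance Definition _ :=
  GRing.isZmodClosed.Build V span_pred span_zmod_closed.

Definition quo_sort : Type := Quotient.quot span_pred.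
HB.instance Definition _ := GRing.Zmodule.on quo_sort.
HB.instance Definition _ := EqQuotient.on quo_sort.

Local Open Scope quotient_scope.

Definition quo_cls (x : V) : quo_sort := \pi_quo_sort x.

Lemma quo_clsP x y : quo_cls x = quo_cls y <-> span S (x - y).
Proof.
rewrite /quo_cls; split=> [/eqP|Sxy]; last apply/eqP.
  by rewrite -Quotient.idealrBE => /asboolP.
by rewrite -Quotient.idealrBE; apply/asboolP.
Qed.

Lemma quo_clsK (q : quo_sort) : quo_cls (repr q) = q. Proof. exact: reprK. Qed.

Lemma quo_cls_repr x : span S (repr (quo_cls x) - x).
Proof. by apply/quo_clsP; rewrite quo_clsK. Qed.

Fact quo_cls_is_additive : {morph quo_cls : x y / x + y}.
Proof. by move=> x y; rewrite /quo_cls raddfD. Qed.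

Definition quo_scale (c : rat) (q : quo_sort) : quo_sort :=
  quo_cls (c *: repr q).

Fact quo_scaleE c x : quo_scale c (quo_cls x) = quo_cls (c *: x).
Proof. by apply/quo_clsP; rewrite -scalerBr; apply/spanZ/quo_cls_repr. Qed.

Fact quo_scaleA c d q : quo_scale c (quo_scale d q) = quo_scale (c * d) q.
Proof. by rewrite -[q]quo_clsK !quo_scaleE scalerA. Qed.

Fact quo_scale1 : left_id 1 quo_scale.
Proof. by move=> q; rewrite /quo_scale scale1r quo_clsK. Qed.

Fact quo_scaleDr : right_distributive quo_scale +%R.
Proof.
move=> c p q; rewrite -[p]quo_clsK -[q]quo_clsK -quo_cls_is_additive.
rewrite !quo_scaleE.
by rewrite scalerDr quo_cls_is_additive.
Qed.

Fact quo_scaleDl q : {morph quo_scale^~ q : c d / c + d}.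
Proof. by move=> c d; rewrite /quo_scale scalerDl quo_cls_is_additive. Qed.

HB.instance Definition _ := GRing.Zmodule_isLmodule.Build rat quo_sort
  quo_scaleA quo_scale1 quo_scaleDr quo_scaleDl.

Fact quo_cls_is_linear : linear quo_cls.
Proof. by move=> c x y; rewrite quo_cls_is_additive -quo_scaleE. Qed.

HB.instance Definition _ :=
  GRing.isLinear.Build rat V quo_sort _ quo_cls quo_cls_is_linear.

End QuotientModule.

(** Later sections take a quotient as a parameter with this interface, so that nothing unfolds to
    the construction above. Its mere inhabitedness is enough, the final goals being propositions. *)
Record quotient (V : lmodType rat) (S : V -> Prop) := Quotient {
  quo :> lmodType rat;
  cls : {linear V -> quo};
  cls_surj : forall q, exists x, cls x = q;
  cls_eq0 : forall x, cls x = 0 <-> span S x }.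

Lemma quotient_exists (V : lmodType rat) (S : V -> Prop) :
  inhabited (quotient S).
Proof.
apply/inhabits/(@Quotient V S (quo_sort S) (quo_cls S)) => [q|x].
  by exists (repr q); apply: quo_clsK.
by rewrite -(linear0 (quo_cls S)) quo_clsP subr0.
Qed.

Section Quotient.
Variables (V : lmodType rat) (S : V -> Prop) (Q : quotient S).

Lemma clsP x y : cls Q x = cls Q y <-> span S (x - y).
Proof.
rewrite -(cls_eq0 Q) linearB; split=> [->|/subr0_eq //]; exact: subrr.
Qed.

Lemma quo_lift_exists (W : lmodType rat) (f : {linear V -> W}) :
  (forall x, S x -> f x = 0) ->
  {g : {linear Q -> W} | forall x, g (cls Q x) = f x}.
Proof.
(* The section [r] is not linear, but [f \o r] is, because [f] kills the ambiguity of
   representatives. *)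
move=> f0; pose r q := sval (cid (cls_surj (q : Q))).
have rE q : cls Q (r q) = q := svalP (cid (cls_surj q)).
have fr x : f (r (cls Q x)) = f x.
  by apply/subr0_eq; rewrite -linearB; apply/(span_eq0 f0)/clsP/rE.
have lin : linear (f \o r).
  by move=> c p q /=; rewrite -[p]rE -[q]rE -linearP !fr linearP.
pose gL := GRing.isLinear.Build rat Q W _ (f \o r) lin.
by exists (HB.pack_for {linear Q -> W} (f \o r) gL).
Qed.
End Quotient.

(** * The exterior algebra *)

Record alternating (L V : lmodType rat) (F : seq L -> V) : Prop := {
  alternatingP : forall s t c x y,
    F (s ++ (c *: x + y) :: t) = c *: F (s ++ x :: t) + F (s ++ y :: t);
  alternating0 : forall r s t x, F (r ++ x :: s ++ x :: t) = 0 }.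

Section Alternating.
Variables (L V : lmodType rat) (F : seq L -> V).
Hypothesis Flin : forall s t c x y,
  F (s ++ (c *: x + y) :: t) = c *: F (s ++ x :: t) + F (s ++ y :: t).
Hypothesis Fadj : forall r t x, F (r ++ x :: x :: t) = 0.

Lemma alternating_swap r t x y :
  F (r ++ x :: y :: t) = - F (r ++ y :: x :: t).
Proof.
have FD s t' a b : F (s ++ (a + b) :: t') = F (s ++ a :: t') + F (s ++ b :: t').
  by rewrite -[a in a + b]scale1r Flin scale1r.
apply/eqP; rewrite -addr_eq0; have := Fadj r t (x + y).
rewrite FD -(cat_rcons x _ ((x + y) :: t)) -(cat_rcons y _ ((x + y) :: t)).
by rewrite !FD !cat_rcons !Fadj add0r addr0 => ->.
Qed.

(** Transpositions bring two equal entries next to each other, each at the cost of a sign. *)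
Lemma alternating_adj : alternating F.
Proof.
split=> // r s; elim: s r => [|y s IH] r t x //=.
by rewrite alternating_swap -cat_rcons IH oppr0.
Qed.

End Alternating.

Section Exterior.
Variables (L : lmodType rat) (ext : quotient (@ext_relator L)).

Definition wedges (s : seq L) : ext := cls ext << s >>.

Lemma wedges_alternating : alternating wedges.
Proof.
split=> [s t c x y|r s t x]; rewrite /wedges.
  by rewrite -linearP; apply/clsP/span_gen/ext_multilinear.
exact/cls_eq0/span_gen/ext_alternating.
Qed.

Lemma ext_span (u : ext) : span (fun v => exists s, v = wedges s) u.
Proof.
have [x <-] := cls_surj (u : ext); rewrite [x]malgZE linear_sum.
apply: span_sum => s _.
by rewrite linearZ_LR; apply/spanZ/span_gen; exists s.
Qed.

Section Lift.
Variables (V : lmodType rat) (F : seq L -> V).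
Hypothesis FA : alternating F.

Fact ext_lift_relator z : ext_relator z -> linext F z = 0.
Proof.
case=> [s t c x y|r s t x]; last by rewrite linextU (alternating0 FA).
by rewrite linearB linearP /= !linextU (alternatingP FA) subrr.
Qed.

Lemma ext_lift_exists : {f : {linear ext -> V} | forall s, f (wedges s) = F s}.
Proof.
have [f fE] := quo_lift_exists ext ext_lift_relator.
by exists f => s; rewrite fE /= linextU.
Qed.
End Lift.

Fact cons_alternating x : alternating (fun s => wedges (x :: s)).
Proof.
split=> [s t c y z|r s t y]; rewrite -cat_cons.
  by rewrite (alternatingP wedges_alternating).
by rewrite (alternating0 wedges_alternating).
Qed.

(* The operators below come from opaque existence lemmas, because unfolding
   them makes unification diverge. *)
Fact wedge_exists : {f : L -> {linear ext -> ext} |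
  forall x s, wedges (x :: s) = f x (wedges s)}.
Proof.
exists (fun x => sval (ext_lift_exists (cons_alternating x))) => x s.
by rewrite (svalP (ext_lift_exists _)).
Qed.

Definition wedge : L -> {linear ext -> ext} := sval wedge_exists.

Lemma wedgesE x s : wedges (x :: s) = wedge x (wedges s).
Proof. exact: (svalP wedge_exists). Qed.

Lemma ext_ind (P : ext -> Prop) :
  P (wedges [::]) -> (forall x u, P u -> P (wedge x u)) ->
  P 0 -> (forall c u v, P u -> P v -> P (c *: u + v)) ->
  forall u, P u.
Proof.
move=> Pnil Pcons P0 PP u; elim: (ext_span u) => {u} [u [s ->]||] //.
  by elim: s => [|x s IH] //; rewrite wedgesE; apply: Pcons.
by move=> c u v _ Pu _ Pv; apply: PP.
Qed.

Lemma ext_eq_linear (V : lmodType rat) (f g : {linear ext -> V}) :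
  f (wedges [::]) = g (wedges [::]) ->
  (forall x u, f u = g u -> f (wedge x u) = g (wedge x u)) -> f =1 g.
Proof.
move=> fg0 fgS; apply: ext_ind => // [|c u v fu fv].
  by rewrite !linear0.
by rewrite !linearP fu fv.
Qed.

Lemma wedgeP c x y u : wedge (c *: x + y) u = c *: wedge x u + wedge y u.
Proof.
elim: (ext_span u) => {u} [u [s ->]||d u v _ IHu _ IHv].
- by rewrite -!wedgesE (alternatingP wedges_alternating [::]).
- by rewrite !linear0 ?scaler0 ?addr0.
rewrite !linearP IHu IHv !scalerDr !scalerA [d * c]mulrC -!addrA.
by congr (_ + _); rewrite addrCA.
Qed.

Lemma wedge0 u : wedge 0 u = 0.
Proof.
have /eqP := wedgeP 1 0 0 u; rewrite !scale1r addr0.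
by rewrite addrC -subr_eq subrr => /eqP.
Qed.

Lemma wedgeD x y u : wedge (x + y) u = wedge x u + wedge y u.
Proof. by rewrite -[x in x + y]scale1r wedgeP scale1r. Qed.

Lemma wedgeZ c x u : wedge (c *: x) u = c *: wedge x u.
Proof. by rewrite -[_ *: x]addr0 wedgeP wedge0 addr0. Qed.

Lemma wedgexx x u : wedge x (wedge x u) = 0.
Proof.
elim: (ext_span u) => {u} [u [s ->]||d u v _ IHu _ IHv].
- by rewrite -!wedgesE (alternating0 wedges_alternating [::] [::]).
- by rewrite !linear0.
by rewrite !(linearP (wedge _)) IHu IHv scaler0 addr0.
Qed.

Lemma wedgeC x y u : wedge x (wedge y u) = - wedge y (wedge x u).
Proof.
apply/eqP; rewrite -addr_eq0; have := wedgexx (x + y) u.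
by rewrite !wedgeD !linearD /= !wedgexx add0r addr0 => ->.
Qed.

(* Lie derivatives (e = 1), contractions (e = -1) and the Chevalley-Eilenberg
   differential (e = -1) satisfy a recursion [f (x /\ u) = A x u + e x /\ f u]. *)
Section Recursion.
Variables (A : L -> {linear ext -> ext}) (e : rat).
Hypothesis AP : forall c x y u, A (c *: x + y) u = c *: A x u + A y u.
Hypothesis Axx : forall x u, A x (wedge x u) + e *: wedge x (A x u) = 0.

Fixpoint rec_word (s : seq L) : ext :=
  if s is x :: s' then A x (wedges s') + e *: wedge x (rec_word s') else 0.

(** On x /\ x /\ u the recursion gives A x (x /\ u) + e x /\ A x u + e^2 x /\ x /\ f u: the first
    two terms cancel by [Axx], and the last one is 0. *)
Fact rec_word_alternating : alternating rec_word.
Proof.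
apply: alternating_adj => [s t c x y|r t x].
  elim: s => [|z s IH] /=.
    rewrite AP wedgeP !scalerDr !scalerA [e * c]mulrC -!addrA.
    by congr (_ + _); rewrite addrCA.
  rewrite IH (alternatingP wedges_alternating).
  rewrite (linearP (A z)) (linearP (wedge z)) !scalerDr !scalerA.
  by rewrite [e * c]mulrC -!addrA; congr (_ + _); rewrite addrCA.
elim: r => [|z r IH] /=; last first.
  rewrite IH (alternating0 wedges_alternating _ [::]).
  by rewrite !linear0 ?scaler0 ?addr0.
by rewrite linearD linearZ_LR wedgexx scaler0 addr0 wedgesE Axx.
Qed.

Lemma ext_rec_exists : {f : {linear ext -> ext} | f (wedges [::]) = 0 &
  forall x u, f (wedge x u) = A x u + e *: wedge x (f u)}.
Proof.
have [f fE] := ext_lift_exists rec_word_alternating; exists f => [|x u].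
  exact: fE.
elim: (ext_span u) => {u} [u [s ->]||d u v _ IHu _ IHv].
- by rewrite -wedgesE !fE.
- by rewrite !linear0 ?scaler0 ?addr0.
rewrite !linearP IHu IHv !scalerDr !scalerA [d * e]mulrC -!addrA.
by congr (_ + _); rewrite addrCA.
Qed.
End Recursion.

Section Derivation.
Variable d : {linear L -> L}.

Fact ext_der_lin c x y u :
  wedge (d (c *: x + y)) u = c *: wedge (d x) u + wedge (d y) u.
Proof. by rewrite linearP wedgeP. Qed.

Fact ext_der_xx x u :
  wedge (d x) (wedge x u) + 1 *: wedge x (wedge (d x) u) = 0.
Proof. by rewrite scale1r wedgeC addNr. Qed.

Definition ext_der : {linear ext -> ext} :=
  s2val (ext_rec_exists ext_der_lin ext_der_xx).

Lemma ext_der0 : ext_der (wedges [::]) = 0.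
Proof. exact: (s2valP (ext_rec_exists ext_der_lin ext_der_xx)). Qed.

Lemma ext_derS x u :
  ext_der (wedge x u) = wedge (d x) u + wedge x (ext_der u).
Proof.
by rewrite (s2valP' (ext_rec_exists ext_der_lin ext_der_xx)) scale1r.
Qed.
End Derivation.

Section Contraction.
Variable phi : {linear L -> rat^o}.

Definition scale_ext (c : rat) : {linear ext -> ext} := ( *:%R c).

Fact contract_lin c x y u : scale_ext (phi (c *: x + y)) u
  = c *: scale_ext (phi x) u + scale_ext (phi y) u.
Proof. by rewrite /scale_ext /= linearP scalerDl scalerA. Qed.

Fact contract_xx x u : scale_ext (phi x) (wedge x u)
  + (-1) *: wedge x (scale_ext (phi x) u) = 0.
Proof. by rewrite /scale_ext /= linearZ_LR scaleN1r subrr. Qed.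

Definition contract : {linear ext -> ext} :=
  s2val (ext_rec_exists contract_lin contract_xx).

Lemma contract0 : contract (wedges [::]) = 0.
Proof. exact: (s2valP (ext_rec_exists contract_lin contract_xx)). Qed.

Lemma contractS x u :
  contract (wedge x u) = phi x *: u - wedge x (contract u).
Proof.
by rewrite (s2valP' (ext_rec_exists contract_lin contract_xx)) scaleN1r.
Qed.
End Contraction.

End Exterior.

(** * The Chevalley-Eilenberg complex *)

Section ChevalleyEilenberg.
Variables (L : lmodType rat) (ext : quotient (@ext_relator L)).
Variables (br : L -> L -> L) (brL : is_lie_bracket br).
Local Notation wedges := (wedges ext).
Local Notation wedge := (wedge ext).

Fact ad_is_linear x : linear (br x).
Proof. by move=> c y z; apply: bracketPr brL _ _ _ _. Qed.

Definition ad x : {linear L -> L} :=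
  HB.pack (br x) (GRing.isLinear.Build rat L L _ (br x) (ad_is_linear x)).

Lemma bracket0r x : br x 0 = 0. Proof. exact: (linear0 (ad x)). Qed.

Lemma bracketZr c x y : br x (c *: y) = c *: br x y.
Proof. exact: (linearZ_LR (ad x)). Qed.

Lemma bracketNr x y : br x (- y) = - br x y.
Proof. exact: (linearN (ad x)). Qed.

Lemma bracketC x y : br x y = - br y x.
Proof.
have := bracketxx brL (x + y).
rewrite -[x in x + y]scale1r (bracketPl brL) !scale1r.
rewrite -[x in x + y]scale1r !(bracketPr brL) !(bracketxx brL) !scale1r.
by rewrite add0r addr0 => /eqP; rewrite addr_eq0 => /eqP.
Qed.

Lemma bracket0l x : br 0 x = 0.
Proof. by rewrite bracketC bracket0r oppr0. Qed.

Lemma bracketZl c x y : br (c *: x) y = c *: br x y.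
Proof. by rewrite bracketC bracketZr -scalerN -bracketC. Qed.

Definition lie_der (d : L -> L) :=
  forall x y, d (br x y) = br (d x) y + br x (d y).

Lemma ad_lie_der x : lie_der (ad x).
Proof.
move=> y z; have /eqP := jacobi brL x y z.
rewrite -addrA addr_eq0 => /eqP /= ->.
rewrite opprD addrC [br (br x y) z]bracketC; congr (_ + _).
by rewrite [br z x]bracketC bracketNr opprK.
Qed.

Definition theta x : {linear ext -> ext} := ext_der ext (ad x).

Lemma thetaP c x y u : theta (c *: x + y) u = c *: theta x u + theta y u.
Proof.
elim/ext_ind: u => [|z u IH||d u v IHu IHv].
- by rewrite /theta !ext_der0 scaler0 addr0.
- rewrite /theta !ext_derS -/(theta _) IH /= (bracketPl brL) wedgeP.
  by rewrite (linearP (wedge z)) scalerDr addrACA.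
- by rewrite !linear0 ?scaler0 ?addr0.
rewrite !linearP IHu IHv !scalerDr !scalerA [d * c]mulrC -!addrA.
by congr (_ + _); rewrite addrCA.
Qed.

Fact ce_lin c x y u :
  (-%R \o theta (c *: x + y)) u = c *: (-%R \o theta x) u + (-%R \o theta y) u.
Proof. by rewrite /= thetaP opprD scalerN. Qed.

Fact ce_xx x u :
  (-%R \o theta x) (wedge x u) + (-1) *: wedge x ((-%R \o theta x) u) = 0.
Proof.
rewrite /= /theta ext_derS /= (bracketxx brL) scaleN1r.
by rewrite wedge0 add0r linearN opprK addNr.
Qed.

Let ext_ce_exists := ext_rec_exists (A := fun x => -%R \o theta x) ce_lin ce_xx.

Definition ext_ce : {linear ext -> ext} := s2val ext_ce_exists.

Lemma ext_ce0 : ext_ce (wedges [::]) = 0.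
Proof. exact: (s2valP ext_ce_exists). Qed.

(** This is Cartan's formula: the anticommutator of the differential and of x /\ is minus the Lie
    derivative. The differential is defined by it, and [cls_ce_diff] identifies it with the explicit
    double sum. *)
Lemma ext_ceS x u : ext_ce (wedge x u) = - theta x u - wedge x (ext_ce u).
Proof. by rewrite (s2valP' ext_ce_exists) scaleN1r. Qed.

Lemma ext_der_theta (d : {linear L -> L}) x u : lie_der d ->
  ext_der ext d (theta x u) = theta (d x) u + theta x (ext_der ext d u).
Proof.
move=> dP; apply: (ext_eq_linear (f := ext_der ext d \o theta x)
  (g := theta (d x) \+ (theta x \o ext_der ext d))) u => [|z u /= IH].
  by rewrite /= /theta !ext_der0 !linear0 addr0.
rewrite /= /theta !ext_derS !linearD /= !ext_derS -!/(theta _) IH dP wedgeD.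
by rewrite linearD !addrA [LHS](ACl (1*5*2*4*3*6))%AC.
Qed.

Lemma ce_ext_der (d : {linear L -> L}) u : lie_der d ->
  ext_ce (ext_der ext d u) = ext_der ext d (ext_ce u).
Proof.
move=> dP; apply: (ext_eq_linear (f := ext_ce \o ext_der ext d)
  (g := ext_der ext d \o ext_ce)) u => [|z u /= IH].
  by rewrite /= ext_der0 ext_ce0 !linear0.
rewrite !(ext_derS, ext_ceS, linearD, linearN) /= IH.
by rewrite ext_der_theta // !opprD !addrA [LHS](ACl (1*3*2*4))%AC.
Qed.

Lemma ce_theta x u : ext_ce (theta x u) = theta x (ext_ce u).
Proof. exact/ce_ext_der/ad_lie_der. Qed.

(** The sign is that of moving the bracket from position j to the front. *)
Lemma theta_sum x s : theta x (wedges s) =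
  \sum_(j < size s) (-1) ^+ j *: wedges (br x s`_j :: remove_at j s).
Proof.
elim: s => [|y s IH]; first by rewrite big_ord0 ext_der0.
rewrite big_ord_recl /= expr0 scale1r {1}/remove_at /= drop0 !wedgesE.
rewrite /theta ext_derS -/(theta x) IH linear_sum; congr (_ + _).
apply: eq_bigr => j _; rewrite linearZ_LR /= !wedgesE wedgeC exprS mulN1r.
by rewrite scaleNr scalerN.
Qed.

Lemma cls_ce_diff c :
  cls ext (ce_diff br c) = ext_ce (cls ext c).
Proof.
rewrite /ce_diff.
set F := (X in linext X); apply: (malg_eq_linear
  (g := cls _ \o linext F) (h := ext_ce \o cls _)) => s /=.
rewrite linextU /F {F} -/(wedges s) linear_sum.
under eq_bigr => j _ do rewrite linear_sum.
elim: s => [|x s IH]; first by rewrite big_ord0 ext_ce0.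
(* The outer index 0 contributes an empty sum. In the other terms, the pairs with i = 0 form
   [- theta x] and the remaining ones the differential of the tail, behind x. *)
rewrite big_ord_recl big_ord0 add0r wedgesE ext_ceS -IH theta_sum.
rewrite (linear_sum (wedge x)) -!sumrN -big_split; apply: eq_bigr => j _ /=.
rewrite big_ord_recl /= linearZ_LR; congr (_ + _).
  by rewrite -scaleNr /remove_at /= drop0 /bump !add0n !add1n exprS mulN1r.
rewrite (linear_sum (wedge x)) -sumrN; apply: eq_bigr => i _.
rewrite !linearZ_LR /= /bump /= !add1n addnS addSn !exprS !mulN1r opprK.
congr (_ *: _).
rewrite -[LHS]/(wedges (br s`_i s`_j :: x :: remove_at i (remove_at j s))).
by rewrite !wedgesE wedgeC -(wedgesE _ (br _ _)).
Qed.

End ChevalleyEilenberg.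

(** * Graded chains *)

(** Applying [G - M] kills the top term and multiplies the v-th one by the nonzero number v - M,
    which leaves a shorter sum. This isolates the weight components of an equation between
    chains. *)
Lemma eigen_sum_eq0 (V : lmodType rat) (G : {linear V -> V}) M (f : nat -> V) :
  (forall v, G (f v) = v%:R *: f v) -> \sum_(v < M) f v = 0 ->
  forall v, (v < M)%N -> f v = 0.
Proof.
elim: M f => [|M IH] f Gf // sf0.
have f0 v : (v < M)%N -> f v = 0.
  move=> vM; have /eqP : (v%:R - M%:R : rat) *: f v = 0.
    apply: (IH (fun v => (v%:R - M%:R : rat) *: f v)) => // [i|].
      by rewrite linearZ_LR Gf !scalerA mulrC.
    have: G (\sum_(v < M.+1) f v) - M%:R *: \sum_(v < M.+1) f v = 0.
      by rewrite sf0 !linear0 addr0.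
    rewrite linear_sum scaler_sumr -sumrB big_ord_recr /= Gf subrr addr0.
    by move=> sE; rewrite -[RHS]sE; apply: eq_bigr => i _; rewrite Gf scalerBl.
  rewrite scaler_eq0 subr_eq0 eqr_nat => /orP[/eqP vM'|/eqP //].
  by rewrite vM' ltnn in vM.
move=> v; rewrite ltnS leq_eqVlt => /orP[/eqP->|/f0 //].
by rewrite big_ord_recr big1 /= ?add0r // in sf0 => i _; apply: f0.
Qed.

Section Chains.
Variables (L : lmodType rat) (ext : quotient (@ext_relator L)).
Variables (br : L -> L -> L) (brL : is_lie_bracket br).
Local Notation wedges := (wedges ext).
Local Notation wedge := (wedge ext).
Local Notation ce := (ext_ce ext brL).
Local Notation theta := (theta ext brL).
Local Notation contract := (contract ext).
Implicit Types (A I J : nat -> L -> Prop) (k m n p q v w : nat) (u b c : ext).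

(** [A m] is the part of weight m of a graded subspace, k counts factors and v adds up their
    weights. Chains of all the ideals live in the exterior algebra of L, which avoids comparing
    exterior algebras of different spaces. *)
Inductive chain_gen A : nat -> nat -> ext -> Prop :=
| chain_nil : chain_gen A 0 0 (wedges [::])
| chain_cons m x k v u of A m x & chain_gen A k v u :
    chain_gen A k.+1 (m + v) (wedge x u).

Definition chain A k v := span (chain_gen A k v).

Definition exact A k v := forall u, chain A k v u -> ce u = 0 ->
  exists2 b, chain A k.+1 v b & ce b = u.

Lemma chain_wedge A m x k v u :
  A m x -> chain A k v u -> chain A k.+1 (m + v) (wedge x u).
Proof.
move=> Ax; apply: (span_map (f := wedge x)) => y Cy.
exact/span_gen/chain_cons.
Qed.

Lemma chain_sub A I k v u :
  (forall m x, I m x -> A m x) -> chain I k v u -> chain A k v u.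
Proof.
move=> IA; apply: span_sub => {}u; elim=> [|m x k' v' u' Ix _ IH].
  exact/span_gen/chain_nil.
exact/chain_wedge/IH/IA.
Qed.

(** In positive degree there is a first factor, and its weight is at most that of the whole
    product. *)
Lemma chain_eq0 A w k v u : (forall m x, (m <= w)%N -> A m x -> x = 0) ->
  (v <= w)%N -> chain A k.+1 v u -> u = 0.
Proof.
move=> A0 vw; suff gen0 k1 v1 u1 : chain_gen A k1 v1 u1 ->
    (0 < k1)%N -> (v1 <= w)%N -> u1 = 0.
  by apply: (span_eq0 (f := idfun)) => {}u /gen0; apply.
case=> // m x k' v' u' Ax _ _ mw; rewrite (A0 m x) ?wedge0 //.
exact: leq_trans (leq_addr v' m) mw.
Qed.

Lemma exact_sub A I k v :
  (forall m x, I m x <-> A m x) -> exact I k v -> exact A k v.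
Proof.
move=> IA eI u Au; case/(eI u)=> [|b Ib bu].
  by apply: chain_sub Au => m x /IA.
by exists b => //; apply: chain_sub Ib => m x /IA.
Qed.

Lemma chain_theta A p x k v u :
  (forall m y, A m y -> A (p + m)%N (br x y)) ->
  chain A k v u -> chain A k (p + v) (theta x u).
Proof.
move=> Ax; apply: (span_map (f := theta x)) => {}u.
elim=> [|m y k' v' u' Ay Cu IH]; first by rewrite /theta ext_der0; apply: span0.
rewrite /theta ext_derS -/(theta x); apply: spanD.
  by rewrite addnA; apply: chain_wedge; [apply: Ax | apply: span_gen].
by rewrite addnCA; apply: chain_wedge.
Qed.

Lemma chain_ce A k v u :
  (forall m x n y, A m x -> A n y -> A (m + n)%N (br x y)) ->
  chain A k v u -> chain A k.-1 v (ce u).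
Proof.
move=> Abr; apply: (span_map (f := ce)) => {}u.
elim=> [|m x k' v' u' Ax Cu IH] /=; first by rewrite ext_ce0; apply: span0.
rewrite ext_ceS; apply: spanB.
  by apply/spanN/chain_theta/span_gen/Cu => n y; apply: Abr.
case: Cu IH => [_|n y k1 v1 u1 Ay Cu IH]; last exact: chain_wedge.
by rewrite ext_ce0 linear0; apply: span0.
Qed.

Lemma chain_contract A (phi : {linear L -> rat^o}) k v u :
  (forall m x, A m x -> phi x = 0) -> chain A k v u -> contract phi u = 0.
Proof.
move=> A0; apply: span_eq0 => {}u; elim=> [|m x k' v' u' Ax _ IH].
  exact: contract0.
by rewrite contractS (A0 _ _ Ax) IH scale0r linear0 subr0.
Qed.

(* Passage from a graded Lie algebra [J] to an ideal [I] of codimension 1 with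
   complement spanned by [x0], homogeneous of weight [p > 0]. *)
Section CodimensionOne.
Variables (I J : nat -> L -> Prop) (p : nat) (x0 : L).
Variable phi : {linear L -> rat^o}.
Hypotheses (p_gt0 : (0 < p)%N) (IJ : forall m x, I m x -> J m x) (Jx0 : J p x0).
Hypotheses (phix0 : phi x0 = 1) (phiI : forall m x, I m x -> phi x = 0).
Hypothesis Jsplit : forall m y, J m y ->
  exists y0 (c : rat), [/\ I m y0, y = y0 + c *: x0 & c = 0 \/ m = p].
Hypothesis Ibr : forall m x n y, I m x -> I n y -> I (m + n)%N (br x y).
Hypothesis Ix0 : forall m y, I m y -> I (p + m)%N (br x0 y).

(** This is where the coefficient of [x0] in a chain of degree k and weight v lies. Equations
    replace the subtractions k - 1 and v - p, whose truncation would allow wrong degrees and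
    weights. *)
Let rest k v := span (fun u =>
  exists k' v', [/\ k = k'.+1, v = (p + v')%N & chain I k' v' u]).

Let restP k v u : rest k v u ->
  u = 0 \/ exists k' v', [/\ k = k'.+1, v = (p + v')%N & chain I k' v' u].
Proof.
elim=> {u} [u Ru||c u u' _ [->|[k1 [v1 [k1E v1E Iu]]]] _ Iu']; first by right.
  by left.
  by rewrite scaler0 add0r.
right; exists k1, v1; split=> //; case: Iu' => [->|[k2 [v2 [k2E v2E Iu']]]].
  by rewrite addr0; apply: spanZ.
move: k1E v1E; rewrite k2E v2E => -[k12] /addnI v12; subst k2 v2.
exact: spanP.
Qed.

Lemma chain_split k v u : chain J k v u ->
  exists u0 u1, [/\ chain I k v u0, u = u0 + wedge x0 u1 & u1 = 0 \/
    exists k' v', [/\ k = k'.+1, v = (p + v')%N & chain I k' v' u1]].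
Proof.
suff: chain J k v u ->
    exists u0 u1, [/\ chain I k v u0, u = u0 + wedge x0 u1 & rest k v u1].
  by move=> H /H[u0 [u1 [Iu0 uE /restP Ru1]]]; exists u0, u1.
elim=> {u} [u||c u u' _ [u0 [u1 [Iu0 -> Ru1]]] _ [u0' [u1' [Iu0' -> Ru1']]]].
- elim=> [|m y k' v' u' Jy _ [u0 [u1 [Iu0 -> Ru1]]]].
    exists (wedges [::]), 0; rewrite linear0 addr0; split=> //.
      exact/span_gen/chain_nil.
    exact: span0.
  have [y0 [c [Iy0 -> cE]]] := Jsplit Jy.
  (* Expand (y0 + c x0) /\ (u0 + x0 /\ u1), using x0 /\ x0 = 0 and y0 /\ x0 = - x0 /\ y0. *)
  exists (wedge y0 u0), (c *: u0 - wedge y0 u1); split.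
  + exact: chain_wedge.
  + rewrite wedgeD !linearD /= wedgeZ (wedgeZ c x0 (wedge x0 u1)) wedgexx.
    rewrite scaler0 addr0 linearN linearZ_LR /= -wedgeC -!addrA.
    by congr (_ + _); rewrite addrC.
  + apply: spanB.
      case: cE => [->|->]; first by rewrite scale0r; apply: span0.
      by apply/spanZ/span_gen; exists k', v'.
    apply: (span_map (f := wedge y0)) Ru1 => z [k1 [v1 [-> -> Iz]]].
    apply: span_gen; exists k1.+1, (m + v1)%N.
    split=> //; first by rewrite addnCA.
    exact: chain_wedge.
- by exists 0, 0; rewrite linear0 addr0; split=> //; apply: span0.
exists (c *: u0 + u0'), (c *: u1 + u1'); split; [exact: spanP| |exact: spanP].
by rewrite (linearP (wedge x0)) scalerDr addrACA.
Qed.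

(** Contraction with [phi] kills the chains of I and sends x0 /\ u to u for such a chain u. Applied
    to [ce u0 - theta x0 u1 - x0 /\ ce u1 = z], it isolates [ce u1]. *)
Let split_cycle k v' u0 u1 z : chain I k.+1 (p + v') u0 -> chain I k v' u1 ->
  chain I k (p + v') z -> ce (u0 + wedge x0 u1) = z ->
  ce u1 = 0 /\ z = ce u0 - theta x0 u1.
Proof.
move=> Iu0 Iu1 Iz; rewrite linearD ext_ceS addrA => zE.
suff u10 : ce u1 = 0 by split=> //; rewrite -zE u10 linear0 subr0.
have Iu0' := chain_ce Ibr Iu0; have It := chain_theta Ix0 Iu1.
apply: oppr_inj; rewrite oppr0 -(chain_contract phiI Iz) -zE linearB contractS.
rewrite phix0 scale1r linearB (chain_contract phiI Iu0').
rewrite (chain_contract phiI It) (chain_contract phiI (chain_ce Ibr Iu1)).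
by rewrite !linear0 !addr0 add0r.
Qed.

(* Nakayama's lemma for the action of [x0] on the homology of [I], by induction
   on the weight *)
Lemma exact_ideal w n : (forall v, (v <= w)%N -> exact J n v) ->
  forall v, (v <= w)%N -> exact I n v.
Proof.
move=> eJ v; elim/ltn_ind: v => v IH vw c Ic ce_c.
have [b Jb bc] := eJ v vw c (chain_sub IJ Ic) ce_c.
have [b0 [b1 [Ib0 bE [b1E|[k' [v' [[kE] vE Ib1]]]]]]] := chain_split Jb.
  by exists b0; rewrite // -bc bE b1E linear0 addr0.
(* Now [c = ce b0 - theta x0 b1] with [b1] a cycle: modulo boundaries, c lies in the image of
   [x0]. *)
subst k' v; have [|ce_b1 cE] := split_cycle Ib0 Ib1 Ic; first by rewrite -bE.
(* Positivity of p makes [b1] a cycle of smaller weight, hence a boundary [ce e]; as [theta x0]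
   commutes with [ce], the second term is a boundary too. *)
have v'lt : (v' < p + v')%N by rewrite -[X in (X < _)%N]add0n ltn_add2r.
have [e Ie eE] := IH v' v'lt (leq_trans (ltnW v'lt) vw) b1 Ib1 ce_b1.
exists (b0 - theta x0 e); first by apply/spanB/chain_theta.
by rewrite linearB ce_theta /= eE cE.
Qed.

(** Write c = c0 + x0 /\ c1. The cycle [c1] has degree n, so it bounds some e, and adding the
    boundary of x0 /\ e to c yields [c0 - theta x0 e], a cycle of I in degree n + 1. *)
Lemma exact_extension w n v : (forall v, (v <= w)%N -> exact I n v) ->
  (v <= w)%N -> exact I n.+1 v -> exact J n.+1 v.
Proof.
move=> eI vw eI1 c Jc ce_c.
have [c0 [c1 [Ic0 cE [c1E|[k' [v' [[kE] vE Ic1]]]]]]] := chain_split Jc.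
  have cc0 : c = c0 by rewrite cE c1E linear0 addr0.
  rewrite cc0 in ce_c *; have [b Ib <-] := eI1 c0 Ic0 ce_c.
  by exists b => //; apply: chain_sub Ib.
subst k' v; rewrite cE in ce_c.
have [ce_c1 /esym/subr0_eq c0E] := split_cycle Ic0 Ic1 (span0 _) ce_c.
have [e Ie eE] := eI v' (leq_trans (leq_addl p v') vw) c1 Ic1 ce_c1.
have [||b Ib bE] := eI1 (c0 - theta x0 e).
- by apply/spanB/chain_theta.
- by rewrite linearB ce_theta /= eE c0E subrr.
exists (b - wedge x0 e).
  by apply: spanB; [apply: chain_sub Ib | apply/chain_wedge/(chain_sub IJ)].
by rewrite linearB ext_ceS bE eE cE opprB opprK addrA addrAC subrK.
Qed.
End CodimensionOne.

End Chains.

(** * Filtration by codimension one ideals *)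

Section Filtration.
Variables (L : lmodType rat) (ext : quotient (@ext_relator L)).
Variables (br : L -> L -> L) (brL : is_lie_bracket br).
Variables (eul : {linear L -> L}) (eul_der : lie_der br eul).
Local Notation exact := (exact ext brL).

(** The grading is encoded by the eigenvalues of a derivation, so no direct sum decomposition has to
    be carried along. *)
Definition homog m (x : L) := eul x = m%:R *: x.

Hypothesis homog0 : forall x, homog 0 x -> x = 0.

Lemma homogP m c x y : homog m x -> homog m y -> homog m (c *: x + y).
Proof. by rewrite /homog linearP => -> ->; rewrite scalerDr !scalerA mulrC. Qed.

Lemma homog_bracket m n x y : homog m x -> homog n y -> homog (m + n) (br x y).
Proof.
move=> hx hy; rewrite /homog eul_der hx hy natrD scalerDl.
by rewrite (bracketZl brL) (bracketZr brL).
Qed.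

(* The functionals [phi i], ordered by weight, cut out the filtration. *)
Variables (w N : nat) (phi : nat -> {linear L -> rat^o}) (wt : nat -> nat).
Hypothesis phi_wt :
  forall i p x, (i < N)%N -> homog p x -> p <> wt i -> phi i x = 0.
Hypothesis phi_sorted : forall i p x, (i < N)%N -> (p < wt i)%N -> homog p x ->
  (forall l, (l < i)%N -> phi l x = 0) -> x = 0.
Hypothesis phi_separates : forall p x, (p <= w)%N -> homog p x ->
  (forall l, (l < N)%N -> phi l x = 0) -> x = 0.

Let fil j m x := homog m x /\ forall l, (l < j)%N -> phi l x = 0.

Let filS j m x : fil j.+1 m x -> fil j m x.
Proof. by move=> [hx x0]; split=> // l lj; apply/x0/ltnW. Qed.

(** By [phi_sorted], a nonzero element of [fil j] has weight at least [wt l] for every l <= j.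
    Weights being positive, a bracket of two such elements has weight above [wt l], where [phi l]
    vanishes. *)
Let fil_bracket j m n x y : (j < N)%N ->
  fil j m x -> fil j n y -> fil j.+1 (m + n) (br x y).
Proof.
move=> jN [hx x0] [hy y0].
have hxy := homog_bracket hx hy; split=> // l lj.
have lN : (l < N)%N by apply: leq_trans jN.
have [mnE|mn] := eqVneq (m + n)%N (wt l); last exact/(phi_wt lN hxy)/eqP.
suff -> : br x y = 0 by apply: linear0.
have [n0|n_gt0] := posnP n.
  by rewrite n0 in hy; rewrite (homog0 hy) (bracket0r brL).
suff -> : x = 0 by rewrite (bracket0l brL).
apply: (phi_sorted lN _ hx) => [|i il].
  by rewrite -mnE -[X in (X < _)%N]addn0 ltn_add2l.
by apply/x0/(leq_trans il).
Qed.

(** Induction on the number d of functionals still to be imposed: [exact_ideal] carries the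
    hypothesis down to the next ideal, and [exact_extension] brings the conclusion back up. *)
Lemma exact_filtration n d j : (j + d = N)%N ->
  (forall v, (v <= w)%N -> exact (fil j) n v) ->
  forall v, (v <= w)%N -> exact (fil j) n.+1 v.
Proof.
elim: d j => [|d IH] j.
  rewrite addn0 => -> _ v vw u Cu _; suff -> : u = 0.
    by exists 0; [apply: span0 | apply: linear0].
  by apply: chain_eq0 vw Cu => m x mw [hx]; apply: phi_separates hx.
rewrite addnS => jd ej; have jN : (j < N)%N by rewrite -jd ltnS leq_addr.
have {}IH := IH j.+1 jd.
(* If [phi j] vanishes on [fil j], the next ideal is the same; otherwise a normalized x with nonzero
   value spans a complement. *)
have [[m [x [[hx x0] phix]]]|noX] :=
    pselect (exists m x, fil j m x /\ phi j x <> 0); last first.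
  have filE m x : fil j.+1 m x <-> fil j m x.
    split=> [/filS //|[hx x0]]; split=> // l; rewrite ltnS leq_eqVlt.
    case/orP=> [/eqP->|/x0 //]; apply: contrapT => phix; apply: noX.
    by exists m, x.
  move=> v vw; apply: (exact_sub filE); apply: IH vw => v' vw'.
  by apply: (exact_sub _ (ej v' vw')) => m x; split=> /filE.
have mE : m = wt j.
  by apply: contrapT => mj; apply/phix/(phi_wt jN hx).
pose y := (phi j x)^-1 *: x.
have phiy : phi j y = 1 by rewrite linearZ_LR; apply/mulVf/eqP.
have fily : fil j m y.
  split=> [|l lj]; first by rewrite /homog linearZ_LR hx !scalerA mulrC.
  by rewrite linearZ_LR (x0 _ lj) scaler0.
have m_gt0 : (0 < m)%N.
  rewrite lt0n; apply/eqP => m0; apply: phix.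
  by rewrite m0 in hx; rewrite (homog0 hx) linear0.
have IJ p z : fil j.+1 p z -> fil j p z by apply: filS.
have phiI p z : fil j.+1 p z -> phi j z = 0 by case=> _; apply.
have Ibr p z q t : fil j.+1 p z -> fil j.+1 q t -> fil j.+1 (p + q) (br z t).
  by move=> /filS Iz /filS It; apply: fil_bracket.
have Iy p z : fil j.+1 p z -> fil j.+1 (m + p) (br y z).
  by move=> /filS; apply: fil_bracket.
have Jsplit p z : fil j p z -> exists z0 (c : rat),
    [/\ fil j.+1 p z0, z = z0 + c *: y & c = 0 \/ p = m].
  move=> [hz z0]; exists (z - phi j z *: y), (phi j z).
  (* Subtracting a multiple of y must not destroy homogeneity: the coefficient is 0 unless z has the
     weight of y. *)
  have c0 : phi j z = 0 \/ p = m.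
    have [pm|pm] := eqVneq p m; [by right | left].
    by apply: (phi_wt jN hz); rewrite -mE; apply/eqP.
  split=> //; last by rewrite subrK.
  split=> [|l].
    case: c0 => [->|pm]; first by rewrite scale0r subr0.
    rewrite addrC -scaleNr; apply: homogP => //.
    by rewrite pm; case: fily.
  rewrite linearB linearZ_LR ltnS leq_eqVlt => /orP[/eqP->|lj].
    by rewrite phiy; apply/eqP; rewrite subr_eq0 /= [_ *: _]mulr1.
  by rewrite (z0 l lj) (fily.2 l lj) scaler0 subr0.
have eI := exact_ideal m_gt0 IJ phiy phiI Jsplit Ibr Iy ej.
move=> v vw; apply: (exact_extension IJ fily phiy phiI Jsplit Ibr Iy eI vw).
exact: IH vw.
Qed.

Lemma exact_homog n : (forall v, (v <= w)%N -> exact homog n v) ->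
  forall v, (v <= w)%N -> exact homog n.+1 v.
Proof.
have homogE m x : fil 0 m x <-> homog m x by split=> [[]|].
move=> eh v vw; apply: (exact_sub homogE).
apply: (exact_filtration (n := n) (add0n N)) vw => v' vw'.
by apply: (exact_sub _ (eh v' vw')) => m x; split=> /homogE.
Qed.

End Filtration.

(** * Vanishing of homology, tested weight by weight *)

Section GradedHomology.
Variables (L : lmodType rat) (ext : quotient (@ext_relator L)).
Variables (br : L -> L -> L) (brL : is_lie_bracket br).
Variables (eul : {linear L -> L}) (eul_der : lie_der br eul).
Hypothesis homog_span : forall x, span (fun y => exists m, homog eul m y) x.
Local Notation wedges := (wedges ext).
Local Notation wedge := (wedge ext).
Local Notation chain := (@chain L ext (homog eul)).
Local Notation exact := (exact ext brL (homog eul)).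
Local Notation ce := (ext_ce ext brL).

Let deg k := span (fun u => exists2 s, size s = k & u = wedges s).

Let cls_deg k c : ext_degree k c -> deg k (cls ext c).
Proof.
move=> cP; rewrite [c]malgZE big_seq linear_sum; apply: span_sum => s /cP sk.
by rewrite linearZ_LR; apply/spanZ/span_gen; exists s.
Qed.

Let deg_cls k u : deg k u -> exists2 c, ext_degree k c & cls ext c = u.
Proof.
elim=> {u} [_ [s sk ->]||c u u' _ [b bk <-] _ [b' bk' <-]].
- exists << s >> => // t; rewrite msuppU oner_eq0 in_fset1 => /eqP->.
  exact: sk.
- by exists 0; [move=> s; rewrite msupp0 in_fset0 | apply: linear0].
exists (c *: b + b'); last by rewrite linearP.
move=> s /(fsubsetP (msuppD_le _ _)); rewrite in_fsetU => /orP[|/bk' //].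
by move/(fsubsetP (msuppZ_le _ _))/bk.
Qed.

Let homology_vanishesE k : homology_vanishes br k <->
  forall u, deg k u -> ce u = 0 -> exists2 b, deg k.+1 b & ce b = u.
Proof.
have ceE c c' : ext_eq (ce_diff br c) c' <-> ce (cls ext c) = cls ext c'.
  by rewrite -cls_ce_diff; split=> /clsP.
split=> H u.
  move=> /deg_cls[c ck <-]; rewrite -(linear0 (cls ext)) => /ceE.
  case/(H _ ck) => b bk /ceE bE; exists (cls ext b) => //.
  exact: cls_deg.
move=> uk /ceE; rewrite linear0 => /(H _ (cls_deg uk))[b /deg_cls[c ck <-]].
by move=> /ceE; exists c.
Qed.

Let chain_deg k v u : chain k v u -> deg k u.
Proof.
apply: span_sub => {}u; elim=> [|m x k' v' u' _ _].
  by apply: span_gen; exists [::].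
apply: (span_map (f := wedge x)) => _ [s sk ->]; apply: span_gen.
by exists (x :: s); rewrite /= ?sk ?wedgesE.
Qed.

Let deg_chain k u : deg k u -> span (fun z => exists v, chain k v z) u.
Proof.
apply: span_sub => _ [s <- ->]; elim: s => [|x s IH].
  by apply: span_gen; exists 0%N; apply/span_gen/chain_nil.
rewrite wedgesE; elim: (homog_span x) => {x} [x [m hx]||c x y _ IHx _ IHy].
- apply: (span_map (f := wedge x)) IH => u' [v Cu].
  by apply: span_gen; exists (m + v)%N; apply: chain_wedge.
- by rewrite wedge0; apply: span0.
by rewrite wedgeP; apply: spanP.
Qed.

Let chain_eul k v u : chain k v u -> ext_der ext eul u = v%:R *: u.
Proof.
elim=> {u} [u||c u u' _ IHu _ IHu'].
- elim=> [|m x k' v' u' hx _ IH]; first by rewrite ext_der0 scale0r.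
  by rewrite ext_derS hx wedgeZ IH linearZ_LR -scalerDl natrD.
- by rewrite !linear0.
by rewrite linearP IHu IHu' scalerDr !scalerA mulrC.
Qed.

Let deg_decomposition k u : deg k u ->
  exists N (f : nat -> ext), (forall v, chain k v (f v)) /\
    forall M, (N <= M)%N -> u = \sum_(v < M) f v.
Proof. by move=> /deg_chain; apply: span_union. Qed.

Let homog_br m x n y :
  homog eul m x -> homog eul n y -> homog eul (m + n) (br x y).
Proof. exact: homog_bracket. Qed.

Lemma homology_vanishes_graded k :
  homology_vanishes br k <-> forall v, exact k v.
Proof.
rewrite homology_vanishesE; split=> [H v u Cu ce_u|H u uk ce_u].
  have [b bk bu] := H u (chain_deg Cu) ce_u.
  have [N [f [Cf bE]]] := deg_decomposition bk.
  (* [g i] is the weight i component of [ce b - u]; as the components sum to 0, each of them is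
     0. *)
  exists (f v) => //; pose g i := ce (f i) - (if i == v then u else 0).
  suff : g v = 0 by rewrite /g eqxx => /subr0_eq.
  (* The range must contain v even when b has no component in that weight. *)
  pose M := maxn N v.+1; have vM : (v < M)%N by rewrite leq_max leqnn orbT.
  apply: (eigen_sum_eq0 (G := ext_der ext eul) (f := g)) (vM) => [i|].
    apply: (chain_eul (k := k)); apply: spanB.
      exact: (chain_ce brL homog_br (Cf i)).
    by case: eqP => [->|_] //; apply: span0.
  rewrite sumrB -linear_sum -(bE M) ?leq_maxl // bu.
  by rewrite -big_mkcond (big_pred1 (Ordinal vM)) ?subrr //.
have [N [f [Cf uE]]] := deg_decomposition uk.
have uN := uE N (leqnn N).
have cef v : (v < N)%N -> ce (f v) = 0.
  apply: (eigen_sum_eq0 (G := ext_der ext eul)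
    (f := fun v => ce (f v))) => [i|].
    exact/(chain_eul (k := k.-1))/(chain_ce brL homog_br (Cf i)).
  by rewrite -linear_sum -uN.
have bP (i : 'I_N) : exists b, chain k.+1 i b /\ ce b = f i.
  by have [b Cb bE] := H i (f i) (Cf i) (cef i (ltn_ord i)); exists b.
have [b bE] := choice bP.
exists (\sum_(i < N) b i).
  by apply: span_sum => i _; apply: chain_deg (bE i).1.
by rewrite linear_sum uN; apply: eq_bigr => i _; case: (bE i).
Qed.

End GradedHomology.

Lemma homology_vanishesS (L : lmodType rat) (br : L -> L -> L)
    (eul : {linear L -> L}) (k : nat) :
  is_lie_bracket br -> lie_der br eul ->
  (forall x, span (fun y => exists m, homog eul m y) x) ->
  (forall x, homog eul 0 x -> x = 0) ->
  (forall w, exists N (phi : nat -> {linear L -> rat^o}) (wt : nat -> nat),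
    [/\ forall i p x, (i < N)%N -> homog eul p x -> p <> wt i -> phi i x = 0,
        forall i p x, (i < N)%N -> (p < wt i)%N -> homog eul p x ->
          (forall l, (l < i)%N -> phi l x = 0) -> x = 0
      & forall p x, (p <= w)%N -> homog eul p x ->
          (forall l, (l < N)%N -> phi l x = 0) -> x = 0]) ->
  homology_vanishes br k -> homology_vanishes br k.+1.
Proof.
move=> brL eul_der eul_span eul0 eul_phi.
have [ext] := quotient_exists (@ext_relator L).
rewrite !(homology_vanishes_graded ext brL eul_der eul_span) => ek w.
(* The bound on weights is the weight w under study, so each weight gets its own finite list of
   functionals. *)
have [N [phi [wt [h1 h2 h3]]]] := eul_phi w.
exact: (exact_homog eul_der eul0 h1 h2 h3 (fun v _ => ek v)) (leqnn w).
Qed.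

(** * The Poisson-Ihara bracket *)

Section FreeModule.
Variable K : choiceType.
Implicit Types f : {malg rat[K]}.

Lemma malg_ind (P : {malg rat[K]} -> Prop) :
  (forall k, P << k >>) -> P 0 ->
  (forall c f g, P f -> P g -> P (c *: f + g)) -> forall f, P f.
Proof.
move=> PU P0 PP f; have: span (fun g => exists k, g = << k >>) f.
  by apply: malg_span => k _; apply: span_gen; exists k.
by elim=> {f} [_ [k ->]||c f g _ Pf _ Pg] //; apply: PP.
Qed.
End FreeModule.

(** * Derivations and commutators in associative algebras *)

Section Leibniz.
Variable A : nzRingType.
Implicit Types x y z : A.

Definition leibniz (d : A -> A) :=
  forall x y, d (x * y) = d x * y + x * d y.

Lemma leibniz_cons (a b p q p' q' : A) :
  a * (p * q) + b * (p' * q + p * q') = (a * p + b * p') * q + (b * p) * q'.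
Proof. by rewrite mulrDr mulrDl !mulrA addrA. Qed.

Lemma leibniz1 (d : A -> A) : leibniz d -> d 1 = 0.
Proof.
move=> dM; have /eqP := dM 1 1.
by rewrite !mulr1 mul1r -[X in X == _]addr0 (inj_eq (addrI _)) eq_sym => /eqP.
Qed.

Lemma leibniz_comm (d d' : {additive A -> A}) :
  leibniz d -> leibniz d' -> leibniz (fun x => d (d' x) - d' (d x)).
Proof.
move=> dM d'M x y; rewrite dM d'M !raddfD /= !dM !d'M mulrBl mulrBr.
(* The permutation places opposite mixed terms side by side for [addrK]. *)
by rewrite !opprD !addrA [LHS](ACl (1*5*4*8*2*7*3*6))%AC /= !addrK.
Qed.

Lemma leibniz_bracket (d : {additive A -> A}) x y :
  leibniz d -> d (comm x y) = comm (d x) y + comm x (d y).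
Proof.
move=> dM; rewrite /comm raddfB /= !dM opprD !addrA.
by rewrite [LHS](ACl (1*4*2*3))%AC.
Qed.

Lemma commD x y z : comm x (y + z) = comm x y + comm x z.
Proof. by rewrite /comm mulrDr mulrDl opprD addrACA. Qed.

Lemma commN x y : comm x (- y) = - comm x y.
Proof. by rewrite /comm mulrN mulNr opprB opprK addrC. Qed.

Lemma comm_jacobi x y z :
  comm x (comm y z) = comm (comm x y) z - comm (comm x z) y.
Proof.
rewrite /comm !(mulrBl, mulrBr) !opprB !mulrA !addrA.
by rewrite [RHS](ACl (1*8*3*6*5*2*7*4))%AC /= !addrK.
Qed.

(** For x = e1, y = f, z = g, t = D_f(g), u = D_g(f), this compares D_<f,g> and [D_f, D_g] at e1. *)
Lemma comm_ihara x y z t u : comm x (comm y z + t - u) =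
  comm (comm x y) z + comm x t - (comm (comm x z) y + comm x u).
Proof.
rewrite (commD x (comm y z + t)) (commD x (comm y z)) commN comm_jacobi.
move: (comm (comm x y) z) (comm (comm x z) y) (comm x t) (comm x u) => p q r s.
by rewrite opprD !addrA [LHS](ACl (1*3*2*4))%AC.
Qed.
Lemma cyclic_sum6 (V : zmodType) (a b c p q r : V) :
  a - b - (c - r) + (c - p - (q - b)) + (q - r - (a - p)) = 0.
Proof.
rewrite !opprB !addrA [LHS](ACl (1*12*7*2*3*10*5*4*11*6*9*8))%AC /=.
by rewrite !addrK subrr.
Qed.

(** This is the commutator of the operators x + d and y + d', where x and y act by left
    multiplication. *)
Lemma leibniz_act (d d' : {additive A -> A}) x y z : leibniz d -> leibniz d' ->
  (x * y - y * x + d y - d' x) * z + (d (d' z) - d' (d z)) =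
  (x * (y * z + d' z) + d (y * z + d' z)) -
  (y * (x * z + d z) + d' (x * z + d z)).
Proof.
move=> dM d'M; rewrite !raddfD /= dM d'M.
rewrite !(mulrDr, mulrDl, mulNr, opprD, mulrA) !addrA.
by rewrite [RHS](ACl (1*6*3*8*5*10*4*7*2*9))%AC /= !addrK.
Qed.
End Leibniz.

Section LeibnizAlgebra.
(* The library makes [ncpoly I] a [lalgType rat] but not an [algType rat]. *)
Variable A : lalgType rat.
Hypothesis mulZr : forall (c : rat) (x y : A), x * (c *: y) = c *: (x * y).
Implicit Types (x y z : A) (c : rat).

Lemma commP c x y z : comm z (c *: x + y) = c *: comm z x + comm z y.
Proof.
by rewrite /comm mulrDr mulrDl mulZr -scalerAl scalerBr opprD addrACA.
Qed.

Lemma mulP_add c x x' x0 y z t t' t0 :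
  x0 = c *: x + x' -> t0 = c *: t + t' ->
  x0 * y + z * t0 = c *: (x * y + z * t) + (x' * y + z * t').
Proof.
by move=> -> ->; rewrite mulrDl mulrDr mulZr -scalerAl scalerDr addrACA.
Qed.

Lemma leibnizPl (d : {linear A -> A}) c x x' y :
  d (x * y) = d x * y + x * d y -> d (x' * y) = d x' * y + x' * d y ->
  d ((c *: x + x') * y) = d (c *: x + x') * y + (c *: x + x') * d y.
Proof.
by move=> H H'; rewrite !(mulrDl, linearD) -!scalerAl !linearZ_LR /=
  -!scalerAl H H' scalerDr addrACA.
Qed.

Lemma leibnizPr (d : {linear A -> A}) c x x' y :
  d (y * x) = d y * x + y * d x -> d (y * x') = d y * x' + y * d x' ->
  d (y * (c *: x + x')) = d y * (c *: x + x') + y * d (c *: x + x').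
Proof.
by move=> H H'; rewrite !linearP /= !mulrDr !mulZr linearP /= H H'
  scalerDr addrACA.
Qed.
End LeibnizAlgebra.

Section NonCommutative.
Variable I : choiceType.
Implicit Types (x y : ncpoly I) (s : seq I) (u v : {fmonom I}).

Lemma ncpolyZr c x y : x * (c *: y) = c *: (x * y).
Proof.
apply/malgP => k; rewrite mcoeffZ.
apply: etrans (mcoeffMlw k (fsubset_refl _) (msuppZ_le c y)) _.
apply: etrans _ (congr1 ( *%R c) (esym (mcoeffMl x y k))); rewrite mulr_sumr.
apply: eq_bigr => u _; rewrite mulr_sumr; apply: eq_bigr => v _.
by rewrite mcoeffZ mulrnAr mulrCA.
Qed.

Lemma mulUU u v : << u >> * << v >> = << fmmul u v >> :> ncpoly I.
Proof. by rewrite [LHS](fgmulUU 1 1 u v) mulr1. Qed.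

Lemma ncpoly1 : 1 = << FMonom [::] >> :> ncpoly I.
Proof. by rewrite -fmoneE. Qed.

Lemma prod_letter s : \prod_(i <- s) letter i = << FMonom s >>.
Proof.
elim: s => [|i s IH]; first by rewrite big_nil ncpoly1.
by rewrite big_cons IH mulUU fmmulE fmuE.
Qed.

Lemma ncpoly_ind (P : ncpoly I -> Prop) :
  (forall s, P << FMonom s >>) -> P 0 ->
  (forall c x y, P x -> P y -> P (c *: x + y)) -> forall x, P x.
Proof. by move=> PU; apply: malg_ind => u; rewrite -[u]fmK. Qed.

Lemma linext_leibniz (F : {fmonom I} -> ncpoly I) :
  (forall s t, F (FMonom (s ++ t)) =
    F (FMonom s) * << FMonom t >> + << FMonom s >> * F (FMonom t)) ->
  leibniz (linext F).
Proof.
move=> FM x y; elim/ncpoly_ind: x => [s||c x x' IH IH'].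
- elim/ncpoly_ind: y => [t||c y y' IH IH'].
  + by rewrite mulUU !linextU fmmulE FM.
  + by rewrite !(mulr0, linear0) addr0.
  + exact: (@leibnizPr (ncpoly I) ncpolyZr (linext F) c y y' << FMonom s >>
      IH IH').
- by rewrite !(mul0r, linear0) add0r.
- exact: (@leibnizPl (ncpoly I) (linext F) c x x' y IH IH').
Qed.

Lemma leibniz_eq (d d' : {linear ncpoly I -> ncpoly I}) :
  leibniz d -> leibniz d' -> (forall i, d (letter i) = d' (letter i)) ->
  d =1 d'.
Proof.
move=> dM d'M dd'; apply: ncpoly_ind => [s||c x y dx dy].
- rewrite -prod_letter; elim: s => [|i s IH].
    by rewrite big_nil (leibniz1 dM) (leibniz1 d'M).
  by rewrite big_cons dM d'M dd' IH.
- by rewrite !linear0.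
by rewrite !linearP dx dy.
Qed.

End NonCommutative.

Section Ihara.
Implicit Types f g h x y : nc2.

Lemma ihara_der_wordP c f g s : ihara_der_word (c *: f + g) s =
  c *: ihara_der_word f s + ihara_der_word g s.
Proof.
elim: s => [|b s IH] /=; first by rewrite scaler0 addr0.
apply: (@mulP_add nc2 (@ncpolyZr bool)) IH.
case: b; last by rewrite scaler0 addr0.
exact: (@commP nc2 (@ncpolyZr bool) c f g e1).
Qed.

Lemma ihara_der_leibniz f : leibniz (ihara_der f).
Proof.
apply: linext_leibniz => s t /=; elim: s => [|b s IH] /=.
  by rewrite mul0r add0r -ncpoly1 mul1r.
rewrite !prod_letter IH.
have -> : << FMonom (s ++ t) >> = << FMonom s >> * << FMonom t >> :> nc2.
  by rewrite mulUU fmmulE.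
have -> : << FMonom (b :: s) >> = letter b * << FMonom s >>.
  by rewrite mulUU fmmulE fmuE.
exact: leibniz_cons.
Qed.

HB.instance Definition _ f := GRing.Linear.copy (ihara_der f)
  (linext (fun w : {fmonom bool} => ihara_der_word f w)).

Lemma ihara_derP c f g x :
  ihara_der (c *: f + g) x = c *: ihara_der f x + ihara_der g x.
Proof.
apply: (malg_eq_linear (g := ihara_der (c *: f + g))
  (h := (c \*: ihara_der f \+ ihara_der g)%R)) => u /=.
by rewrite /ihara_der !linextU ihara_der_wordP.
Qed.

Lemma ihara_der_e0 f : ihara_der f e0 = 0.
Proof. by rewrite /ihara_der linextU fmuE /= mul0r mulr0 addr0. Qed.

Lemma ihara_der_e1 f : ihara_der f e1 = comm e1 f.
Proof. by rewrite /ihara_der linextU fmuE /= big_nil mulr1 mulr0 addr0. Qed.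

(** Both sides are derivations in x, hence determined by their values at e0 and e1. The identity
    makes f -> D_f a morphism of Lie algebras. *)
Lemma ihara_der_ihara f g x : ihara_der (ihara f g) x =
  ihara_der f (ihara_der g x) - ihara_der g (ihara_der f x).
Proof.
apply: (leibniz_eq (d := ihara_der (ihara f g))
  (d' := (ihara_der f \o ihara_der g) \- (ihara_der g \o ihara_der f))).
- exact: ihara_der_leibniz.
- exact: leibniz_comm (ihara_der_leibniz f) (ihara_der_leibniz g).
case=> /=; first last.
  by rewrite -/e0 !ihara_der_e0 !linear0 addr0.
rewrite -/e1 !ihara_der_e1 !leibniz_bracket; try exact: ihara_der_leibniz.
rewrite /= !ihara_der_e1; exact: comm_ihara.
Qed.

(* The infinitesimal action on the path torsor.  As it is a Lie action and
   [ihara f g] is [ihara_act f g - ihara_act g f], the Jacobi identity follows. *)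
Definition ihara_act f x := f * x + ihara_der f x.

Lemma iharaE f g : ihara f g = ihara_act f g - ihara_act g f.
Proof. by rewrite /ihara /comm /ihara_act opprD addrACA addrA. Qed.

Lemma ihara_actB f x y : ihara_act f (x - y) = ihara_act f x - ihara_act f y.
Proof. by rewrite /ihara_act mulrBr linearB /= opprD addrACA. Qed.

Lemma ihara_act_ihara f g x : ihara_act (ihara f g) x =
  ihara_act f (ihara_act g x) - ihara_act g (ihara_act f x).
Proof.
rewrite /ihara_act ihara_der_ihara.
exact: (leibniz_act f g x (ihara_der_leibniz f) (ihara_der_leibniz g)).
Qed.

Lemma ihara_jacobi f g h :
  ihara f (ihara g h) + ihara g (ihara h f) + ihara h (ihara f g) = 0.
Proof.
have ihE x y z : ihara x (ihara y z) =
    ihara_act x (ihara_act y z) - ihara_act x (ihara_act z y) -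
    (ihara_act y (ihara_act z x) - ihara_act z (ihara_act y x)).
  rewrite (iharaE x (ihara y z)) (ihara_act_ihara y z x) (iharaE y z).
  by congr (_ - _); apply: ihara_actB.
rewrite (ihE f g h) (ihE g h f) (ihE h f g); exact: cyclic_sum6.
Qed.

End Ihara.

Section ActAlgebra.
Variable A : lalgType rat.
Hypothesis mulZr : forall (c : rat) (x y : A), x * (c *: y) = c *: (x * y).
Implicit Types (x y z t : A) (c : rat).

Lemma actPl c x x' y t t' t0 : t0 = c *: t + t' ->
  (c *: x + x') * y + t0 = c *: (x * y + t) + (x' * y + t').
Proof. by move=> ->; rewrite mulrDl -scalerAl scalerDr addrACA. Qed.

Lemma actPr c x x' y t t' t0 : t0 = c *: t + t' ->
  y * (c *: x + x') + t0 = c *: (y * x + t) + (y * x' + t').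
Proof. by move=> ->; rewrite mulrDr mulZr scalerDr addrACA. Qed.
End ActAlgebra.

Lemma scaleB_eq (V : lmodType rat) (c : rat) (x y z t x0 y0 : V) :
  x0 = c *: x + y -> y0 = c *: z + t ->
  x0 - y0 = c *: (x - z) + (y - t).
Proof. by move=> -> ->; rewrite scalerBr opprD addrACA. Qed.

Lemma mcoeffP (K : choiceType) (c : rat) (f g : {malg rat[K]}) k :
  (c *: f + g)@_k = c * f@_k + g@_k.
Proof. by rewrite mcoeffD mcoeffZ. Qed.

(** * Bilinearity of the bracket and the weight derivation *)

Section IharaEuler.
Implicit Types (f g h x y : nc2) (c : rat).

Lemma ihara_actPl c f g x :
  ihara_act (c *: f + g) x = c *: ihara_act f x + ihara_act g x.
Proof. exact: (@actPl nc2 c f g x _ _ _ (ihara_derP c f g x)). Qed.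

Lemma ihara_actPr c f x y :
  ihara_act f (c *: x + y) = c *: ihara_act f x + ihara_act f y.
Proof.
exact: (@actPr nc2 (@ncpolyZr bool) c x y f _ _ _
  (linearP (ihara_der f) c x y)).
Qed.

Lemma iharaPl c f g h : ihara (c *: f + g) h = c *: ihara f h + ihara g h.
Proof.
rewrite (iharaE (c *: f + g)) (iharaE f) (iharaE g).
exact: scaleB_eq (ihara_actPl c f g h) (ihara_actPr c h f g).
Qed.

Lemma iharaPr c f g h : ihara h (c *: f + g) = c *: ihara h f + ihara h g.
Proof.
rewrite (iharaE h) (iharaE h f) (iharaE h g).
exact: scaleB_eq (ihara_actPr c h f g) (ihara_actPl c f g h).
Qed.

Lemma iharaff f : ihara f f = 0.
Proof. by rewrite iharaE subrr. Qed.

Definition euler : nc2 -> nc2 :=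
  linext (fun w : {fmonom bool} => (weight w)%:R *: << w >>).

HB.instance Definition _ := GRing.Linear.copy euler
  (linext (fun w : {fmonom bool} => (weight w)%:R *: << w >>)).

Lemma euler_coef f (w : {fmonom bool}) : (euler f)@_w = (weight w)%:R * f@_w.
Proof.
elim/malg_ind: f => [u||c f g fw gw].
- rewrite /euler linextU mcoeffZ mcoeffU.
  by case: eqP => [->|_] //; rewrite !mulr0n !mulr0.
- by rewrite linear0 !mcoeff0 mulr0.
by rewrite linearP (mcoeffP c f g) (mcoeffP c (euler f)) fw gw mulrDr mulrCA.
Qed.

Lemma weight_part_coef n f (w : {fmonom bool}) :
  (weight_part n f)@_w = if weight w == n then f@_w else 0.
Proof.
rewrite /weight_part /part; elim/malg_ind: f => [u||c f g fw gw].
- rewrite linextU; case: (eqVneq u w) => [->|uw].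
    by case: ifP => // _; rewrite mcoeff0.
  by case: ifP => _; rewrite ?mcoeff0 ?mcoeffU (negPf uw) ?if_same.
- by rewrite linear0 mcoeff0 if_same.
rewrite linearP (mcoeffP c f g) mcoeffP fw gw.
by case: ifP => _; rewrite // mulr0 addr0.
Qed.

Lemma euler_leibniz : leibniz euler.
Proof.
apply: linext_leibniz => s t.
have sZ (a b : nc2) (n m : rat) :
    (n + m) *: (a * b) = (n *: a) * b + a * (m *: b).
  by rewrite ncpolyZr -scalerAl scalerDl.
rewrite /weight /= size_cat natrD.
have -> : << FMonom (s ++ t) >> = << FMonom s >> * << FMonom t >> :> nc2.
  by rewrite mulUU fmmulE.
exact: sZ.
Qed.

Lemma euler_letter b : euler (letter b) = letter b.
Proof. by rewrite /euler linextU /weight fmU scale1r. Qed.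

Lemma euler_ihara_der f x :
  euler (ihara_der f x) = ihara_der (euler f) x + ihara_der f (euler x).
Proof.
(* In commutator form both sides are derivations. At e1, which has weight 1, the subtracted term
   [e1, f] cancels the contribution of [euler e1]. *)
suff E : euler (ihara_der f x) - ihara_der f (euler x) = ihara_der (euler f) x.
  by move/eqP: E; rewrite subr_eq => /eqP.
apply: (leibniz_eq (d' := ihara_der (euler f))
  (d := (euler \o ihara_der f) \- (ihara_der f \o euler))).
- exact: leibniz_comm euler_leibniz (ihara_der_leibniz f).
- exact: ihara_der_leibniz.
case=> /=; rewrite euler_letter; first last.
  by rewrite -/e0 !ihara_der_e0 !linear0 addr0.
rewrite -/e1 !ihara_der_e1 (leibniz_bracket _ _ euler_leibniz) /=.
by rewrite [euler e1]euler_letter [comm e1 f + _]addrC addrK.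
Qed.

Lemma euler_ihara f g :
  euler (ihara f g) = ihara (euler f) g + ihara f (euler g).
Proof.
have actE x y : euler (ihara_act x y) =
    ihara_act (euler x) y + ihara_act x (euler y).
  rewrite /ihara_act linearD /= euler_leibniz euler_ihara_der.
  exact: addrACA.
have eB (V : zmodType) (e : {additive V -> V}) (x y a b c d : V) :
    e x = a + b -> e y = c + d -> e (x - y) = (a - d) + (b - c).
  move=> ex ey; rewrite raddfB ex ey opprD !addrA.
  by rewrite [LHS](ACl (1*4*2*3))%AC.
rewrite (iharaE f g) (iharaE (euler f)) (iharaE f (euler g)).
exact: (@eB nc2 euler _ _ _ _ _ _ (actE f g) (actE g f)).
Qed.

Lemma free_lie_coef1 f : free_lie f -> f@_(fmone bool) = 0.
Proof.
elim=> {f} [b||c f g _ f0 _ g0|f g _ f0 _ g0].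
- by rewrite mcoeffU fmuE fmoneE.
- exact: mcoeff0.
- by rewrite mcoeffD mcoeffZ f0 g0 mulr0 addr0.
pose ev : {rmorphism nc2 -> rat} := mcoeff (fmone bool).
have ev0 x y : ev x = 0 -> ev (x * y) = 0.
  by rewrite rmorphM => ->; apply: mul0r.
rewrite /comm mcoeffB [X in X - _](ev0 f g f0) [X in _ - X](ev0 g f g0).
exact: subr0.
Qed.

Lemma weight_decomposition f : exists N, f = \sum_(n < N) weight_part n f.
Proof.
pose N := (\max_(w <- msupp f) weight (w : {fmonom bool})).+1; exists N.
apply/malgP => w; rewrite raddf_sum /=.
under eq_bigr => n _ do rewrite weight_part_coef.
have [wf|wf] := boolP (w \in msupp f); last first.
  rewrite (mcoeff_outdom wf) big1 // => n _; exact: if_same.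
have wN : (weight w < N)%N by rewrite ltnS (bigD1_seq w) ?leq_maxl ?fset_uniq.
by rewrite -big_mkcond (big_pred1 (Ordinal wN)).
Qed.
End IharaEuler.

(** * Bigraded Lie algebras *)

Section BigradedHomology.
Variable a : bigraded_lie.
Local Notation A := (bl_type a).
Local Notation br := (@bl_bracket a).
Implicit Types x y z : A.

Lemma bl_bracket_is_lie : is_lie_bracket br.
Proof.
split=> [c x y z|c x y z|x|x y z]; apply: val_inj.
- exact: iharaPl.
- exact: iharaPr.
- exact: iharaff.
- exact: ihara_jacobi.
Qed.

(** On each weight part [euler] is a scalar, and a bigraded Lie algebra contains the weight parts of
    its elements. *)
Fact bl_euler_subproof x : euler (val x) \in bl_pred a.
Proof.
have [N ->] := weight_decomposition (val x); rewrite linear_sum /=.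
apply: rpred_sum => n _; suff -> : euler (weight_part n (val x)) =
  n%:R *: weight_part n (val x) by apply/rpredZ/bl_weight/(valP x).
apply/malgP => w; rewrite euler_coef mcoeffZ weight_part_coef.
by case: eqP => [->|_] //; rewrite !mulr0.
Qed.

Definition bl_euler_fun x : A := exist _ (euler (val x)) (bl_euler_subproof x).

Fact bl_euler_is_linear : linear bl_euler_fun.
Proof. by move=> c x y; apply: val_inj; exact: (linearP euler). Qed.

HB.instance Definition _ :=
  GRing.isLinear.Build rat A A _ bl_euler_fun bl_euler_is_linear.

Definition bl_euler : {linear A -> A} := bl_euler_fun.

Lemma bl_euler_der : lie_der br bl_euler.
Proof. by move=> x y; apply: val_inj; exact: euler_ihara. Qed.

Lemma homogE m x : homog bl_euler m x <->
  forall w : {fmonom bool}, weight w != m -> (val x)@_w = 0.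
Proof.
split=> [hx w wm|x0].
  have /(congr1 (fun f => f@_w)) : euler (val x) = m%:R *: val x.
    exact: (congr1 val hx).
  rewrite euler_coef mcoeffZ => /eqP; rewrite -subr_eq0 -mulrBl mulf_eq0.
  by rewrite subr_eq0 eqr_nat (negPf wm) => /eqP.
apply: val_inj; apply/malgP => w.
apply: etrans (euler_coef _ _) _; apply: etrans _ (esym (mcoeffZ _ _ _)).
by have [->|/x0->] := eqVneq (weight w) m; rewrite ?mulr0.
Qed.

Lemma homog_span x : span (fun y => exists m, homog bl_euler m y) x.
Proof.
have [N xE] := weight_decomposition (val x).
pose y n : A := exist _ (weight_part n (val x)) (bl_weight n (valP x)).
have -> : x = \sum_(n < N) y n by apply: val_inj; rewrite linear_sum.
apply: span_sum => n _; apply: span_gen; exists n; apply/homogE => w.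
by rewrite /= weight_part_coef => /negPf->.
Qed.

Lemma homog0_eq0 x : homog bl_euler 0 x -> x = 0.
Proof.
move/homogE => x0; apply: val_inj; apply/malgP => w; rewrite mcoeff0.
have [w0|/x0 //] := eqVneq (weight w) 0%N.
have -> : w = fmone bool.
  by rewrite fmoneE -[w]fmK; congr FMonom; apply: size0nil.
exact/free_lie_coef1/(lie_subalgebra_sub (bl_lie a) (valP x)).
Qed.

Definition bl_coef_fun (w : {fmonom bool}) x : rat^o := (val x)@_w.

Fact bl_coef_is_linear w : linear (bl_coef_fun w).
Proof. by move=> c x y; apply: mcoeffP. Qed.

HB.instance Definition _ w :=
  GRing.isLinear.Build rat A rat^o _ (bl_coef_fun w) (bl_coef_is_linear w).

Definition bl_coef w : {linear A -> rat^o} := bl_coef_fun w.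

(** The concatenation is already ordered by length; [sort] makes this order available through
    [sort_sorted]. *)
Definition words n : seq (seq bool) :=
  sort (fun s t => size s <= size t)%N
    (flatten [seq [seq tval t | t : m.-tuple bool] | m <- iota 0 n.+1]).

Lemma mem_words n s : (size s <= n)%N -> s \in words n.
Proof.
move=> sn; rewrite mem_sort; apply/flattenP.
exists [seq tval t | t : (size s).-tuple bool].
  by apply/mapP; exists (size s); rewrite ?mem_iota ?add0n ?ltnS.
by apply/mapP; exists (in_tuple s) => //; rewrite mem_enum.
Qed.

Lemma bl_functionals w :
  exists N (phi : nat -> {linear A -> rat^o}) (wt : nat -> nat),
  [/\ forall i p x, (i < N)%N -> homog bl_euler p x -> p <> wt i -> phi i x = 0,
      forall i p x, (i < N)%N -> (p < wt i)%N -> homog bl_euler p x ->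
        (forall l, (l < i)%N -> phi l x = 0) -> x = 0
    & forall p x, (p <= w)%N -> homog bl_euler p x ->
        (forall l, (l < N)%N -> phi l x = 0) -> x = 0].
Proof.
exists (size (words w)), (fun i => bl_coef (FMonom (nth [::] (words w) i))).
exists (fun i => size (nth [::] (words w) i)).
(* Out of range, [nth] returns the empty word, which satisfies the bound as well. *)
have words_le i : (size (nth [::] (words w) i) <= w)%N.
  have [iN|/(nth_default [::])->] // := ltnP i (size (words w)).
  have := mem_nth [::] iN; rewrite mem_sort => /flattenP[_ /mapP[m mw ->]].
  move=> /mapP[t _ ->]; rewrite size_tuple.
  by move: mw; rewrite mem_iota add0n ltnS.
(* An element of weight p is 0 once its coefficients vanish on an initial segment containing all
   words of length p. This serves both for the words before i and for the whole list. *)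
have sep p x n : (n <= size (words w))%N -> (p <= w)%N -> homog bl_euler p x ->
    (forall s : seq bool, size s = p -> (index s (words w) < n)%N) ->
    (forall l, (l < n)%N -> bl_coef (FMonom (nth [::] (words w) l)) x = 0) ->
    x = 0.
  move=> nN pw /homogE hx sn x0; apply: val_inj; apply/malgP => u.
  rewrite mcoeff0.
  have [up|/hx //] := eqVneq (weight u) p.
  have := x0 _ (sn u up); rewrite nth_index ?fmK //.
  by apply: mem_words; rewrite -[size u]/(weight u) up.
split=> [i p x iN /homogE hx /eqP pw|i p x iN pi hx x0|p x pw hx x0].
- by apply: hx; rewrite eq_sym.
- apply: (sep p x i) => //; [exact: ltnW| exact/ltnW/(leq_trans pi) |].
  (* A word of length p placed at i or later would contradict the order, since the i-th word is
     longer than p. *)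
  move=> s sp; rewrite ltnNge; apply/negP => il.
  have sw : s \in words w.
    by apply: mem_words; rewrite sp; apply/ltnW/(leq_trans pi).
  have tot : total (fun s t : seq bool => size s <= size t)%N.
    by move=> s1 s2; apply: leq_total.
  have tr : transitive (fun s t : seq bool => size s <= size t)%N.
    by move=> s1 s2 s3; apply: leq_trans.
  have rf : reflexive (fun s t : seq bool => size s <= size t)%N.
    by move=> s1; apply: leqnn.
  have: (size (nth [::] (words w) i) <=
         size (nth [::] (words w) (index s (words w))))%N.
    apply: (sorted_leq_nth tr rf [::] (sort_sorted tot _)) il => //.
    by rewrite inE index_mem.
  by rewrite nth_index // sp leqNgt pi.
apply: (sep p x (size (words w))) => // s sp.
by rewrite index_mem; apply: mem_words; rewrite sp.
Qed.

Lemma bigraded_homology_vanishesS k :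
  homology_vanishes br k -> homology_vanishes br k.+1.
Proof.
exact: (homology_vanishesS bl_bracket_is_lie bl_euler_der homog_span homog0_eq0
  bl_functionals).
Qed.

End BigradedHomology.

Theorem theorem5p3 (R : realType) (a : bigraded_lie) :
  (exists2 u, motivic_lie R u & forall f, f \in bl_pred a <-> gr_dpth u f) \/
  (forall f, f \in bl_pred a <-> gr_dpth grt1 f) \/
  (forall f, f \in bl_pred a <-> gr_dpth ds0 f) \/
  (forall f, f \in bl_pred a <-> ls f) ->
  ((forall k, (3 <= k)%N -> homology_vanishes (@bl_bracket a) k) <->
   homology_vanishes (@bl_bracket a) 3).
Proof.
move=> _; split=> [H|H3]; first exact: H.
elim=> // k IH; rewrite leq_eqVlt => /orP[/eqP<- //|k3].
exact/bigraded_homology_vanishesS/IH.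
Qed.
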